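(* Let $l$ and $n_1,\dots,n_l$ be positive integers, and let $\prod_{i=1}^l\Delta^{n_i}$ be the product of the simplices $\Delta^{n_i}$ of dimension $n_i$. Let $\sharp DJ\left(\prod_{i=1}^l \Delta^{n_i}\right)$ denote the number of Davis-Januszkiewicz equivalence classes of small covers over $\prod_{i=1}^l\Delta^{n_i}$. Then $$\sharp DJ\left(\prod_{i=1}^l \Delta^{n_i}\right)=\sum_{G\in\mathcal{G}_l}\ \prod_{v_i\in V(G)}(2^{n_i}-1)^{\mathrm{outdeg}(v_i)},$$ where $\mathcal{G}_l$ is the set of acyclic digraphs with $l$ labeled nodes and $V(G)=\{v_1,\dots,v_l\}$ is the labeled vertex set of $G$.
   Context: $\mathbb{Z}_2$ denotes the group (field) with two elements. Digraphs: a digraph on labeled nodes $v_1,\dots,v_l$ has at most one edge directed from $v_i$ to $v_j$, for each $1\le i\le l$, $1\le j\le l$. It is acyclic if it has no directed cycle of any length (in particular no loops and no directed 2-cycles). Acyclic digraphs with labeled nodes are counted without identifying isomorphic ones. $\mathrm{outdeg}(v_i)$ is the number of directed edges with initial vertex $v_i$. Small covers: let $P$ be a simple convex polytope of dimension $n$ (here $P=\prod_{i=1}^l\Delta^{n_i}$ and $n=\sum_{i=1}^l n_i$). The standard action of $\mathbb{Z}_2^n$ on $\mathbb{R}^n$ is by sign changes of the coordinates; a $\mathbb{Z}_2^n$-action on an $n$-manifold is locally standard if it is locally isomorphic, up to an automorphism of $\mathbb{Z}_2^n$, to the standard action. A small cover over $P$ is a smooth closed manifold $M$ of dimension $n$ with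 a locally standard $\mathbb{Z}_2^n$-action whose orbit space is $P$ (identified as a manifold with corners); it thus comes with a projection $\pi: M\to P$ whose fibers are the orbits. Davis-Januszkiewicz equivalence: two small covers $\pi_1:M_1\to P$ and $\pi_2:M_2\to P$ are Davis-Januszkiewicz (D-J) equivalent if there are an automorphism $\varphi$ of $\mathbb{Z}_2^n$ and a homeomorphism $f: M_1\to M_2$ such that $f(t\cdot x)=\varphi(t)\cdot f(x)$ for all $t\in\mathbb{Z}_2^n$, $x\in M_1$, and $f$ covers the identity on $P$, i.e. $\pi_2\circ f=\pi_1$. *)

(* Defs.v *)
From HB Require Import structures.
From mathcomp Require Import all_boot all_order all_algebra.
From mathcomp Require Import all_classical all_reals all_analysis.

Set Implicit Arguments.
Unset Strict Implicit.
Unset Printing Implicit Defensive.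

Import Order.TTheory GRing.Theory Num.Theory.
Import numFieldNormedType.Exports.

Local Open Scope classical_set_scope.
Local Open Scope ring_scope.

(* The group Z_2^n, written additively. *)
Notation Z2 n := 'rV['F_2]_n.

Section SmoothStructures.
Context {R : realType} {n : nat}.
Local Notation E := 'rV[R]_n.

Definition iter_derive (vs : seq E) (f : E -> E) : E -> E :=
  foldr (fun v g => 'D_v g) f vs.

(* C^oo on A: all iterated directional derivatives exist and are continuous at
   every point of A. Only used for open A, where the values of f outside A are
   irrelevant. *)
Definition smooth_on (A : set E) (f : E -> E) : Prop :=
  forall (vs : seq E) (x : E), A x ->
    {for x, continuous (iter_derive vs f)} /\
    forall v : E, derivable (iter_derive vs f) x v.

Context {M : topologicalType}.

(* chart_fun and chart_inv are total; only their restrictions to chart_dom c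
   and chart_cod c are meaningful. *)
Record chart := Chart {
  chart_dom : set M;
  chart_fun : M -> E;
  chart_inv : E -> M }.

Definition chart_cod (c : chart) : set E := chart_fun c @` chart_dom c.

Definition is_chart (c : chart) : Prop :=
  [/\ open (chart_dom c), open (chart_cod c),
      forall x, chart_dom c x -> chart_inv c (chart_fun c x) = x,
      forall x, chart_dom c x -> {for x, continuous (chart_fun c)} &
      forall y, chart_cod c y -> {for y, continuous (chart_inv c)}].

Definition smooth_transition (c c' : chart) : Prop :=
  smooth_on (chart_fun c @` (chart_dom c `&` chart_dom c'))
            (chart_fun c' \o chart_inv c).

Definition smooth_atlas (A : set chart) : Prop :=
  [/\ forall c, A c -> is_chart c,
      forall x, exists2 c, A c & chart_dom c x &
      forall c c', A c -> A c' -> smooth_transition c c'].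

(* Membership in the maximal smooth atlas containing A. *)
Definition smooth_chart (A : set chart) (c : chart) : Prop :=
  is_chart c /\
  forall c', A c' -> smooth_transition c c' /\ smooth_transition c' c.

Definition standard_act (t : Z2 n) (x : E) : E :=
  \row_j ((-1) ^+ (t 0 j : nat) * x 0 j).

(* A diffeomorphism from an invariant open subset of M onto an (automatically
   invariant) open subset of R^n which is equivariant up to an automorphism of
   Z_2^n. *)
Definition standard_chart (A : set chart) (act : Z2 n -> M -> M) (c : chart) :
    Prop :=
  [/\ smooth_chart A c,
      forall t x, chart_dom c x -> chart_dom c (act t x) &
      exists2 phi : {additive Z2 n -> Z2 n}, bijective phi &
        forall t x, chart_dom c x ->
          chart_fun c (act t x) = standard_act (phi t) (chart_fun c x)].

End SmoothStructures.
Arguments chart : clear implicits.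

Definition zeros {R : realType} {m : nat} (x : 'rV[R]_m) : nat :=
  #|[pred j : 'I_m | x 0 j == 0]|.

Section ProductOfSimplices.
Context {R : realType} {l : nat} (n : 'I_l -> nat).

Definition simplex (m : nat) : set 'rV[R]_m.+1 :=
  [set p | (forall j, 0 <= p 0 j) /\ \sum_j p 0 j = 1].

Definition simplex_prod_space : topologicalType :=
  prod_topology (fun i : 'I_l => 'rV[R]_(n i).+1).

Definition simplex_prod : set simplex_prod_space :=
  [set p | forall i, simplex (p i)].

(* The facets of the product are the loci where one of the barycentric
   coordinates vanishes, so this is the codimension of the smallest face
   containing p. *)
Definition num_facets (p : simplex_prod_space) : nat :=
  (\sum_(i < l) zeros (p i))%N.

End ProductOfSimplices.
Arguments simplex_prod_space R {l} n.
Arguments simplex_prod R {l} n.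

Section SmallCovers.
Context (R : realType) (l : nat) (n : 'I_l -> nat).
Local Notation N := (\sum_(i < l) n i)%N.

(* By sc_proj_cont, sc_proj_range and sc_proj_fib, sc_proj induces a continuous
   bijection from the orbit space onto the polytope, hence a homeomorphism since
   sc_carrier is compact. The charts of the orbit space as a manifold with
   corners are the maps to (R_{>=0})^N induced by the standard charts, and
   sc_corners says that this homeomorphism preserves the codimension, i.e. is an
   isomorphism of manifolds with corners. *)
Record small_cover := SmallCover {
  sc_carrier :> topologicalType;
  sc_hausdorff : hausdorff_space sc_carrier;
  sc_compact : compact [set: sc_carrier];
  sc_atlas : set (chart R N sc_carrier);
  sc_smooth : smooth_atlas sc_atlas;
  sc_act : Z2 N -> sc_carrier -> sc_carrier;
  sc_act0 : forall x, sc_act 0 x = x;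
  sc_actD : forall (s t : Z2 N) x, sc_act (s + t) x = sc_act s (sc_act t x);
  sc_standard : forall x,
    exists2 c, standard_chart sc_atlas sc_act c & chart_dom c x;
  sc_proj : sc_carrier -> simplex_prod_space R n;
  sc_proj_cont : continuous sc_proj;
  sc_proj_range : range sc_proj = simplex_prod R n;
  sc_proj_fib : forall x y,
    sc_proj x = sc_proj y <-> exists t, y = sc_act t x;
  sc_corners : forall c x, standard_chart sc_atlas sc_act c ->
    chart_dom c x -> zeros (chart_fun c x) = num_facets (sc_proj x) }.

Definition DJ_equiv (M1 M2 : small_cover) : Prop :=
  exists (phi : {additive Z2 N -> Z2 N}) (f : M1 -> M2) (g : M2 -> M1),
    [/\ bijective phi,
        [/\ continuous f, continuous g, cancel f g & cancel g f],
        forall t x, f (sc_act t x) = sc_act (phi t) (f x) &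
        forall x, sc_proj (f x) = sc_proj x].

Lemma DJ_equiv_refl (M : small_cover) : DJ_equiv M M.
Proof.
exists idfun, idfun, idfun; split=> //.
by split=> // x; exact: cvg_id.
Qed.

Lemma DJ_equiv_sym (M1 M2 : small_cover) : DJ_equiv M1 M2 -> DJ_equiv M2 M1.
Proof.
move=> [phi [f [g [[psi phiK psiK] [fc gc fK gK] fE fp]]]].
have psiD : zmod_morphism psi.
  by move=> s t; apply: (can_inj phiK); rewrite psiK raddfB !psiK.
pose psiA : {additive Z2 N -> Z2 N} :=
  HB.pack psi (GRing.isZmodMorphism.Build _ _ _ psiD).
exists psiA, g, f; split=> //; first by exists phi.
  by move=> t x; apply: (can_inj fK); rewrite fE /= psiK !gK.
by move=> x; rewrite -fp gK.
Qed.

Lemma DJ_equiv_trans (M1 M2 M3 : small_cover) :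
  DJ_equiv M1 M2 -> DJ_equiv M2 M3 -> DJ_equiv M1 M3.
Proof.
move=> [phi [f [g [phib [fc gc fK gK] fE fp]]]].
move=> [phi' [f' [g' [phib' [fc' gc' fK' gK'] fE' fp']]]].
exists (phi' \o phi), (f' \o f), (g \o g'); split.
- exact: bij_comp.
- split; [| |exact: can_comp|exact: can_comp].
    by move=> x; apply: continuous_comp; [exact: fc|exact: fc'].
  by move=> x; apply: continuous_comp; [exact: gc'|exact: gc].
- by move=> t x /=; rewrite fE fE'.
- by move=> x /=; rewrite fp' fp.
Qed.

End SmallCovers.

(* For an equivalence relation E on T: the set of equivalence classes has
   exactly N elements. The classes are predicates T -> Prop rather than
   elements of set T because small_cover does not fit in the universe of set. *)
Definition num_classes (T : Type) (E : T -> T -> Prop) (N : nat) : Prop :=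
  exists2 C : 'I_N -> (T -> Prop), injective C &
    forall A : T -> Prop, (exists i, C i = A) <-> (exists x, A = E x).

Section Digraphs.
Context {l : nat}.

(* A digraph on the labeled nodes 'I_l, given by its set of edges. *)
Definition digraph : Type := {set 'I_l * 'I_l}.

Definition edge (G : digraph) : rel 'I_l := fun i j => (i, j) \in G.

Definition acyclic (G : digraph) : Prop :=
  ~ exists2 c : seq 'I_l, c <> [::] & ucycle (edge G) c.

Definition outdeg (G : digraph) (i : 'I_l) : nat :=
  #|[pred j : 'I_l | edge G i j]|.

End Digraphs.
Arguments digraph : clear implicits.

(* Main.v *)
Require Import Defs.
From HB Require Import structures.
From mathcomp Require Import all_boot all_order all_algebra.
From mathcomp Require Import all_classical all_reals all_analysis.
From mathcomp Require Import lra.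

(** Small covers are classified by their isotropy groups, and these are counted
    by linear algebra over the field with two elements.

    Let [M] be a small cover. Over the relative interior of a facet the isotropy
    group has order two; its generator is the characteristic vector of the facet
    ([lam]). In a chart, facets through a point correspond to the vanishing
    coordinates ([chart_facets]), so the isotropy group over any point is freely
    spanned by the vectors of the facets through it ([fix_comb],
    [lam_nonsingular]). After an automorphism of the group, the facets
    through a fixed vertex have the standard basis as their vectors, and the
    vectors of the [l] remaining facets, one for each factor, are the rows of a
    matrix [A] ([normal_form]). Thus [M] has a normal form [A]
    ([has_form_exists]), which is unique ([has_form_inj]).

    The normal form determines the class. The projection is a finite covering
    over the interior of the polytope, and the polytope is contracted to its
    barycentre along segments that stay in the interior until they end; lifting
    these segments gives a section of the projection ([section_exists]). An
    equivariant bijection is obtained by translating one section to another; it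
    is well defined when the isotropy groups correspond, and a homeomorphism
    because preimages of closed sets are finite unions of closed sets
    ([DJ_equiv_of_isotropy]).

    Every good matrix occurs. The group of all sign changes of coordinates acts
    on the product of the unit spheres, and squaring the coordinates identifies
    its quotient with the product of simplices. The subgroup of the relations
    between the characteristic vectors acts freely precisely because the vectors
    are nonsingular, and the quotient by it is a small cover with the prescribed
    isotropy groups ([model_has_form]). Its charts are the affine charts of
    projective geometry, one for each vertex of the polytope; their transition
    maps are locally rational.

    It remains to count the good matrices. Split the rows of [A] into blocks,
    one for each factor. The combination of the relations indexed by a set [U]
    of factors is [1] on the whole of a factor [k] in [U] when the blocks at [k]
    of the rows in [U] add up to the all-ones vector. For singletons this says
    that the diagonal blocks are all-ones vectors. The rest of the condition says
    that the digraph with an edge from [k] to [i] when the block at [k] of row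
    [i] is nonzero contains no cycle ([good_blocks]). Given the digraph, each of
    its edges from [k] allows [2 ^ n k - 1] nonzero blocks, whence the formula
    ([card_good]). *)

Set Implicit Arguments.
Unset Strict Implicit.
Unset Printing Implicit Defensive.
Import Order.TTheory GRing.Theory Num.Theory.
Import numFieldNormedType.Exports.

(** * Sign changes and convergence *)

Section Convergence.
Local Open Scope classical_set_scope.
Local Open Scope ring_scope.

Lemma cvg_rowP (R : realType) (m : nat) (T : Type) (F : set_system T)
    {FF : Filter F} (f : T -> 'rV[R]_m) (y : 'rV[R]_m) :
  (forall j, f x 0 j @[x --> F] --> y 0 j) -> f x @[x --> F] --> y.
Proof.
move=> h A [P Py sPA]; apply: (filterS sPA).
apply: filter_forall => i; apply: filter_forall => j.
by rewrite (ord1 i); apply: h; exact: Py.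
Qed.

Lemma cvg_prodP (I : eqType) (K : I -> topologicalType) (T : Type)
    (F : set_system T) {FF : Filter F} (f : T -> prod_topology K)
    (y : prod_topology K) :
  (forall i, f x i @[x --> F] --> y i) -> f x @[x --> F] --> y.
Proof.
move=> h; apply/cvg_sup => i A [_ [[B oB <-] By] sBA].
apply: (filterS sBA); apply: (h i).
exact: open_nbhs_nbhs.
Qed.

Lemma cvg_sumr (R : realType) (I T : Type) (F : set_system T) {FF : Filter F}
    (r : seq I) (g : I -> T -> R) (a : I -> R) :
  (forall i, g i x @[x --> F] --> a i) ->
  \sum_(i <- r) g i x @[x --> F] --> \sum_(i <- r) a i.
Proof.
move=> ga; elim: r => [|i r IH].
  by rewrite big_nil; under eq_fun do rewrite big_nil; exact: cvg_cst.
rewrite big_cons; under eq_fun do rewrite big_cons.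
by apply: cvgD.
Qed.

(** Both the set where [P] holds and its complement are relatively open. Applied
    along segments, this takes the place of monodromy arguments. *)
Lemma connected_locally_constant (T : topologicalType) (A : set T)
    (P : T -> Prop) :
  connected A ->
  (forall x, A x -> \forall y \near x, A y -> (P x <-> P y)) ->
  forall x y, A x -> A y -> P x -> P y.
Proof.
move=> Aco loc x y Ax Ay Px.
have DE Q : open [set z | \forall w \near z, A w -> Q w].
  by rewrite openE => z /= /nbhs_interior.
have eqP : A `&` [set z | \forall w \near z, A w -> P w] = A `&` P.
  rewrite eqEsubset; split=> z [Az h]; split => //=.
    by apply: (nbhs_singleton h).
  by apply: filterS (loc z Az) => w hw Aw; apply/(hw Aw).
have eqN : A `&` ~` [set z | \forall w \near z, A w -> ~ P w] = A `&` P.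
  rewrite eqEsubset; split=> z [Az h]; split => //=.
    apply: contrapT => nP; apply: h => /=.
    by apply: filterS (loc z Az) => w hw Aw /(hw Aw).
  by move=> /nbhs_singleton /(_ Az).
suff : A `<=` A `&` P by move=> /(_ y Ay) [].
rewrite (Aco (A `&` P)) //.
- by exists x.
- by exists [set z | \forall w \near z, A w -> P w].
- exists (~` [set z | \forall w \near z, A w -> ~ P w]); last by rewrite eqN.
  by rewrite closedC.
Qed.

End Convergence.

Section SignActions.
Local Open Scope ring_scope.

Lemma F2_case (x : 'F_2) : x = 0 \/ x = 1.
Proof.
case: x => [[|[|//]] h]; [left|right]; exact/val_inj.
Qed.

Lemma F2_neq0 (x : 'F_2) : (x != 0) = (x == 1).
Proof. by case: (F2_case x) => ->. Qed.

Lemma F2_inj (x y : 'F_2) : (x != 0) = (y != 0) -> x = y.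
Proof. by case: (F2_case x) => ->; case: (F2_case y) => ->. Qed.

Lemma F2_addxx (x : 'F_2) : x + x = 0.
Proof. by case: (F2_case x) => ->; exact/val_inj. Qed.

Lemma F2_opp (x : 'F_2) : - x = x.
Proof. by case: (F2_case x) => ->; exact/val_inj. Qed.

Lemma Z2_addxx m (t : Z2 m) : t + t = 0.
Proof. by apply/rowP => j; rewrite !mxE F2_addxx. Qed.

Lemma Z2_opp m (t : Z2 m) : - t = t.
Proof. by apply/rowP => j; rewrite !mxE F2_opp. Qed.

Lemma additive_inverse (V W : zmodType) (phi : {additive V -> W}) :
  bijective phi -> exists psi : {additive W -> V}, cancel phi psi /\ cancel psi phi.
Proof.
case=> psi phiK psiK.
have psiD : zmod_morphism psi.
  by move=> s t; apply: (can_inj phiK); rewrite psiK raddfB !psiK.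
pose psiA : {additive W -> V} :=
  HB.pack psi (GRing.isZmodMorphism.Build _ _ _ psiD).
by exists psiA.
Qed.

Context {R : realType}.

Definition sgn (a : 'F_2) : R := (-1) ^+ (a : nat).

Lemma sgn0 : sgn 0 = 1. Proof. by rewrite /sgn expr0. Qed.
Lemma sgn1 : sgn 1 = -1. Proof. by rewrite /sgn expr1. Qed.

Lemma sgnD a b : sgn (a + b) = sgn a * sgn b.
Proof.
by case: (F2_case a) => ->; case: (F2_case b) => ->;
  rewrite ?F2_addxx ?addr0 ?add0r ?sgn0 ?sgn1 ?mulr1 ?mul1r ?mulrN1 ?opprK.
Qed.

Lemma sgn_neq0 a : sgn a != 0.
Proof. by case: (F2_case a) => ->; rewrite ?sgn0 ?sgn1 ?oppr_eq0 oner_eq0. Qed.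

Lemma sgn_sqr a : sgn a * sgn a = 1.
Proof. by rewrite -sgnD F2_addxx sgn0. Qed.

Lemma norm_sgn a : `|sgn a| = 1.
Proof. by case: (F2_case a) => ->; rewrite ?sgn0 ?sgn1 ?normrN normr1. Qed.

Lemma sgn_fix a (x : R) : sgn a * x = x <-> (a = 0 \/ x = 0).
Proof.
case: (F2_case a) => ->; rewrite ?sgn0 ?sgn1 ?mul1r ?mulN1r.
  by split => // _; left.
split=> [h|[|->]]; last 2 first.
- by move/eqP; rewrite oner_eq0.
- by rewrite oppr0.
by right; lra.
Qed.

Definition sbit (x : R) : 'F_2 := if x < 0 then 1 else 0.

Lemma sgn_sbit x : sgn (sbit x) * x = `|x|.
Proof.
by rewrite /sbit; case: ltrP => h; rewrite ?sgn1 ?sgn0 ?mulN1r ?mul1r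
  ?(ltr0_norm h) ?(ger0_norm h).
Qed.

Lemma sbit_sgn a x : x != 0 -> sbit (sgn a * x) = a + sbit x.
Proof.
move=> x0; rewrite /sbit.
case: (F2_case a) => ->; rewrite ?sgn0 ?sgn1 ?mul1r ?mulN1r ?add0r//.
rewrite oppr_lt0; case: ltgtP x0 => //= _ _; first by rewrite addr0.
by rewrite F2_addxx.
Qed.

Section Standard.
Context {m : nat}.
Implicit Types (s t : Z2 m) (x y : 'rV[R]_m).

Definition vabs x : 'rV[R]_m := \row_j `|x 0 j|.

Lemma standard_actE t x j : standard_act t x 0 j = sgn (t 0 j) * x 0 j.
Proof. by rewrite mxE. Qed.

Lemma standard_act_fix t x :
  standard_act t x = x <-> forall j, t 0 j = 0 \/ x 0 j = 0.
Proof.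
split=> [h j|h].
  by apply/sgn_fix; move/rowP: h => /(_ j); rewrite standard_actE.
by apply/rowP => j; rewrite standard_actE; exact/sgn_fix.
Qed.

Lemma vabs_standard_act t x : vabs (standard_act t x) = vabs x.
Proof. by apply/rowP => j; rewrite !mxE normrM norm_sgn mul1r. Qed.

Lemma standard_act_vabs x : exists t, standard_act t x = vabs x.
Proof.
exists (\row_j sbit (x 0 j)); apply/rowP => j.
by rewrite standard_actE !mxE sgn_sbit.
Qed.

Lemma zerosE x : zeros x = #|[set j | x 0 j == 0]%SET|.
Proof. by rewrite cardsE. Qed.

Lemma continuous_standard_act t : continuous (@standard_act R m t).
Proof.
move=> x; apply: (cvg_rowP (F := nbhs x)) => j; under eq_fun do rewrite standard_actE.
rewrite standard_actE; apply: cvgM; first exact: cvg_cst.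
exact: coord_continuous.
Qed.

Lemma continuous_vabs : continuous vabs.
Proof.
move=> x; apply: (cvg_rowP (F := nbhs x)) => j; under eq_fun do rewrite mxE.
rewrite mxE; apply: cvg_norm; exact: coord_continuous.
Qed.

Lemma standard_chart_fix (T : topologicalType) (act : Z2 m -> T -> T)
    (c : chart R m T) (phi : Z2 m -> Z2 m) (x : T) t :
  (forall x : T, chart_dom c x -> chart_inv c (chart_fun c x) = x) ->
  (forall t (x : T), chart_dom c x -> chart_dom c (act t x)) ->
  (forall t (x : T), chart_dom c x ->
    chart_fun c (act t x) = standard_act (phi t) (chart_fun c x)) ->
  chart_dom c x ->
  act t x = x <-> forall j, phi t 0 j = 0 \/ chart_fun c x 0 j = 0.
Proof.
move=> cK cact h xc; rewrite -standard_act_fix -h//; split=> [->//|e].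
by have := congr1 (chart_inv c) e; rewrite !cK//; exact: cact.
Qed.

End Standard.
End SignActions.

(** * The product of simplices and its facets *)

Section Polytope.
Local Open Scope classical_set_scope.
Local Open Scope ring_scope.
Context {R : realType} {l : nat} {n : 'I_l -> nat}.
Local Notation X := (simplex_prod_space R n).
Local Notation facet := {i : 'I_l & 'I_(n i).+1}.

Local Notation fct i j := (existT (fun k : 'I_l => 'I_(n k).+1) i j).

(** Facets of the product are indexed by pairs of a factor and a vertex of it;
    [bary p f] is the barycentric coordinate that vanishes on the facet [f]. *)
Definition bary (p : X) (f : facet) : R := p (tag f) 0 (tagged f).

Definition zset (p : X) : {set facet} := [set f | bary p f == 0]%SET.

Lemma num_facetsE (p : X) : num_facets p = #|zset p|.
Proof.
rewrite /num_facets /zeros.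
under eq_bigr do rewrite -sum1_card.
rewrite sig_big_dep /= -sum1_card; apply: eq_big => // -[i j].
by rewrite !inE.
Qed.

Lemma hausdorff_simplex_prod_space : hausdorff_space X.
Proof.
apply: (@hausdorff_product 'I_l (fun i => 'rV[R]_(n i).+1)) => i.
exact: norm_hausdorff.
Qed.

Lemma continuous_bary f : continuous (bary^~ f).
Proof.
move=> p.
have h : (fun q : X => q (tag f)) @ p --> p (tag f).
  exact: (@proj_continuous _ (fun i => 'rV[R]_(n i).+1)).
apply: (@continuous_comp _ _ _ (fun q : X => q (tag f)) (fun v => v 0 (tagged f))).
  exact: h.
exact: coord_continuous.
Qed.

Lemma cvg_bary (T : Type) (F : set_system T) {FF : Filter F} (g : T -> X)
    (p : X) :
  (forall f, bary (g x) f @[x --> F] --> bary p f) -> g x @[x --> F] --> p.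
Proof.
move=> h; apply: cvg_prodP => i; apply: cvg_rowP => j.
exact: (h (fct _ j)).
Qed.

Lemma bary_ge0 p f : simplex_prod R n p -> 0 <= bary p f.
Proof. by move=> /(_ (tag f)) [] + _; exact. Qed.

Lemma bary_ext (p q : X) : (forall f, bary p f = bary q f) -> p = q.
Proof.
move=> h; apply: functional_extensionality_dep => i; apply/rowP => j.
exact: (h (fct _ j)).
Qed.

Definition segm (p q : X) (u : R) : X := fun i => (1 - u) *: p i + u *: q i.

Lemma bary_segm p q u f :
  bary (segm p q u) f = (1 - u) * bary p f + u * bary q f.
Proof. by rewrite /bary /segm !mxE. Qed.

Lemma segm0 p q : segm p q 0 = p.
Proof. by apply: bary_ext => f; rewrite bary_segm subr0 mul1r mul0r addr0. Qed.

Lemma segm1 p q : segm p q 1 = q.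
Proof. by apply: bary_ext => f; rewrite bary_segm subrr mul1r mul0r add0r. Qed.

Lemma segm_simplex p q u : 0 <= u <= 1 ->
  simplex_prod R n p -> simplex_prod R n q -> simplex_prod R n (segm p q u).
Proof.
move=> /andP[u0 u1] hp hq i; have [p0 p1] := hp i; have [q0 q1] := hq i.
split=> [j|].
  by rewrite !mxE addr_ge0// mulr_ge0// subr_ge0.
under eq_bigr do rewrite !mxE.
by rewrite big_split/= -!mulr_sumr p1 q1 !mulr1 subrK.
Qed.

Lemma continuous_segm p q : continuous (segm p q).
Proof.
move=> u; apply: (cvg_bary (F := nbhs u)) => f.
under eq_fun do rewrite bary_segm.
rewrite bary_segm; apply: cvgD; apply: cvgM; try exact: cvg_cst.
  by apply: cvgB; [exact: cvg_cst|exact: cvg_id].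
exact: cvg_id.
Qed.

Lemma cvg_segm (T : topologicalType) (p : X) (h : T -> X) (x : T) (u : R) :
  continuous h ->
  segm p (h z.1) z.2 @[z --> (nbhs x, nbhs u)] --> segm p (h x) u.
Proof.
move=> hc; apply: cvg_bary => f.
under eq_fun do rewrite bary_segm.
have c2 : (z.2 @[z --> (nbhs x, nbhs u)]) --> u by exact: cvg_snd.
rewrite bary_segm; apply: cvgD; apply: cvgM => //; try exact: cvg_cst.
  by apply: cvgB => //; exact: cvg_cst.
have c1 : z.1 @[z --> (nbhs x, nbhs u)] --> x by exact: cvg_fst.
have h1 : h z.1 @[z --> (nbhs x, nbhs u)] --> h x.
  exact: (continuous_cvg _ (hc x) c1).
exact: (continuous_cvg _ (@continuous_bary f _) h1).
Qed.

Lemma continuous_segm_end (T : topologicalType) (p : X) (h : T -> X) (u : R) :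
  continuous h -> continuous (fun x => segm p (h x) u).
Proof.
move=> hc x; apply: (cvg_bary (F := nbhs x)) => f.
under eq_fun do rewrite bary_segm.
rewrite bary_segm; apply: cvgD; apply: cvgM; try exact: cvg_cst.
exact: (continuous_cvg _ (@continuous_bary f _) (hc x)).
Qed.

(** The barycentre of the face that is the intersection of the facets in [S]. *)
Definition face_center (S : {set facet}) : X := fun i =>
  \row_j ((fct _ j \notin S)%:R /
     (\sum_(k < (n i).+1) (fct _ k \notin S)%:R)).

Lemma face_centerP (S : {set facet}) :
  (forall i : 'I_l, exists j, fct i j \notin S) ->
  simplex_prod R n (face_center S) /\ zset (face_center S) = S.
Proof.
move=> hS.
have pos i : 0 < \sum_(k < (n i).+1)
    (fct _ k \notin S)%:R :> R.
  have [j hj] := hS i.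
  rewrite (bigD1 j)//= hj ltr_pwDl// sumr_ge0// => k _; exact: ler0n.
split.
  move=> i; split=> [j|].
    by rewrite !mxE divr_ge0// ?ler0n// ltW.
  under eq_bigr do rewrite mxE.
  by rewrite -mulr_suml divff// gt_eqF.
apply/setP => -[i j]; rewrite inE /bary !mxE/= mulf_eq0 invr_eq0.
rewrite (gt_eqF (pos i)) orbF pnatr_eq0 eqb0 negbK.
by [].
Qed.

End Polytope.

(** * Local structure of a small cover *)

Section LocalStructure.
Local Open Scope classical_set_scope.
Local Open Scope ring_scope.
Context {R : realType} {l : nat} {n : 'I_l -> nat} (M : small_cover R n).
Local Notation N := (\sum_(i < l) n i)%N.
Local Notation X := (simplex_prod_space R n).
Local Notation facet := {i : 'I_l & 'I_(n i).+1}.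
Local Notation act := (@sc_act R l n M).
Local Notation proj := (@sc_proj R l n M).
Local Notation std := (standard_chart (@sc_atlas R l n M) act).
Implicit Types (c : chart R N M) (x y : M) (t : Z2 N).

Lemma actK t x : act t (act t x) = x.
Proof. by rewrite -sc_actD Z2_addxx sc_act0. Qed.

Lemma proj_act t x : proj (act t x) = proj x.
Proof. by apply/esym/sc_proj_fib; exists t. Qed.

Lemma proj_simplex x : simplex_prod R n (proj x).
Proof. by rewrite -(@sc_proj_range R l n M); exists x. Qed.

Lemma proj_surj (p : X) : simplex_prod R n p -> exists x, proj x = p.
Proof. by rewrite -(@sc_proj_range R l n M) => -[x _ <-]; exists x. Qed.

Section Chart.
Variables (c : chart R N M) (cstd : std c).

Lemma std_is_chart : is_chart c. Proof. by have [[]] := cstd. Qed.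

Lemma open_dom : open (chart_dom c).
Proof. by have [] := std_is_chart. Qed.

Lemma chart_funK x : chart_dom c x -> chart_inv c (chart_fun c x) = x.
Proof. by have [_ _ + _ _] := std_is_chart; exact. Qed.

Lemma chart_fun_cvg x : chart_dom c x -> {for x, continuous (chart_fun c)}.
Proof. by have [_ _ _ + _] := std_is_chart; exact. Qed.

Lemma chart_inv_cvg (y : 'rV[R]_N) : chart_cod c y -> {for y, continuous (chart_inv c)}.
Proof. by have [_ _ _ _] := std_is_chart; exact. Qed.

Lemma chart_codP x : chart_dom c x -> chart_cod c (chart_fun c x).
Proof. by exists x. Qed.

Lemma chart_invP (y : 'rV[R]_N) : chart_cod c y ->
  chart_dom c (chart_inv c y) /\ chart_fun c (chart_inv c y) = y.
Proof. by move=> [x xc <-]; rewrite chart_funK. Qed.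

Lemma dom_act t x : chart_dom c x -> chart_dom c (act t x).
Proof. by have [_ + _] := cstd; exact. Qed.

Lemma std_phi : exists2 phi : {additive Z2 N -> Z2 N}, bijective phi &
  forall t x, chart_dom c x ->
    chart_fun c (act t x) = standard_act (phi t) (chart_fun c x).
Proof. by have [_ _ h] := cstd. Qed.

Lemma cod_standard_act t (y : 'rV[R]_N) : chart_cod c y ->
  chart_cod c (standard_act t y) /\
  exists s, chart_inv c (standard_act t y) = act s (chart_inv c y).
Proof.
move=> [x xc <-]; have [phi [psi phiK psiK] h] := std_phi.
have e : standard_act t (chart_fun c x) = chart_fun c (act (psi t) x).
  by rewrite h// psiK.
rewrite e; split; first by apply: chart_codP; exact: dom_act.
by exists (psi t); rewrite !chart_funK//; exact: dom_act.
Qed.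

Lemma cod_vabs (y : 'rV[R]_N) : chart_cod c y ->
  chart_cod c (vabs y) /\ exists s, chart_inv c (vabs y) = act s (chart_inv c y).
Proof.
by have [t <-] := standard_act_vabs y => /(cod_standard_act t).
Qed.

Lemma chart_same_orbit x y : chart_dom c x -> chart_dom c y ->
  proj x = proj y -> vabs (chart_fun c x) = vabs (chart_fun c y).
Proof.
move=> xc yc /sc_proj_fib [t ->]; have [phi _ h] := std_phi.
by rewrite h// vabs_standard_act.
Qed.

(** In each orbit meeting the domain, the point with nonnegative coordinates:
    a section of the projection over the image of the chart. *)
Definition lsec (q : X) : M :=
  chart_inv c (vabs (chart_fun c
    (xget (chart_inv c 0) [set y | chart_dom c y /\ proj y = q]))).

Lemma lsecE y : chart_dom c y ->
  lsec (proj y) = chart_inv c (vabs (chart_fun c y)).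
Proof.
move=> yc; rewrite /lsec; case: xgetP => [z -> [zc zy]|/(_ y) /=].
  by congr (chart_inv c _); exact: chart_same_orbit.
by move=> h; exfalso; apply: h; split.
Qed.

Lemma proj_lsec y : chart_dom c y -> proj (lsec (proj y)) = proj y.
Proof.
move=> yc; rewrite lsecE//.
by have [_ [s ->]] := cod_vabs (chart_codP yc); rewrite proj_act chart_funK.
Qed.

Lemma zeros_chart y : chart_dom c y -> zeros (chart_fun c y) = #|zset (proj y)|.
Proof. by move=> yc; rewrite (sc_corners cstd yc) num_facetsE. Qed.

Lemma open_cod : open (chart_cod c).
Proof. by have [] := std_is_chart. Qed.

End Chart.

Lemma continuous_act t : continuous (act t).
Proof.
move=> x; have [c cstd xc] := sc_standard x.
have [phi _ h] := std_phi cstd.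
have e : \forall y \near x,
    (chart_inv c \o (standard_act (phi t) \o chart_fun c)) y = act t y.
  apply: filterS (open_nbhs_nbhs (conj (open_dom cstd) xc)) => y yc /=.
  by rewrite -h// (chart_funK cstd)//; exact: dom_act.
rewrite /continuous_at -(nbhs_singleton e).
apply: cvg_trans (near_eq_cvg e) _.
apply: continuous_comp.
  apply: continuous_comp; first exact: chart_fun_cvg.
  exact: continuous_standard_act.
apply: (chart_inv_cvg cstd) => /=.
by apply: (cod_standard_act cstd _ _).1; exact: chart_codP.
Qed.

(** The projection is open onto the polytope: the complement of the saturation
    of an open set is compact, so its image is closed. *)
Lemma proj_nbhs x (A : set M) : nbhs x A ->
  \forall q \near proj x, simplex_prod R n q -> exists2 y, A y & proj y = q.
Proof.
rewrite nbhsE => -[B [oB Bx] sBA].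
pose C := \bigcap_t ~` (act t @^-1` B).
have cC : closed C.
  apply: closed_bigI => t _; rewrite closedC.
  by apply: open_comp => // y _; exact: continuous_act.
have kC : closed (proj @` C).
  apply: compact_closed; first exact: hausdorff_simplex_prod_space.
  apply: continuous_compact.
    by apply: continuous_subspaceT; exact: sc_proj_cont.
  exact: (subclosed_compact cC (@sc_compact R l n M)).
have o : open (~` (proj @` C)) by rewrite openC.
have px : (~` (proj @` C)) (proj x).
  move=> [y Cy /esym/esym/sc_proj_fib [t xy]].
  by apply: (Cy t) => //=; rewrite -xy.
apply: filterS (open_nbhs_nbhs (conj o px)) => q nq /proj_surj [y yq].
have nCy : ~ C y by move=> Cy; apply: nq; exists y.
move: nCy => /existsNP [t /not_implyP [_ /contrapT By]].
by exists (act t y); [exact: sBA|rewrite proj_act].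
Qed.

Lemma near_dom c x : std c -> chart_dom c x ->
  \forall q \near proj x, simplex_prod R n q ->
    exists2 y, chart_dom c y & proj y = q.
Proof.
move=> cstd xc; apply: proj_nbhs.
exact: (open_nbhs_nbhs (conj (open_dom cstd) xc)).
Qed.

Lemma lsec_cvg c x (T : Type) (F : set_system T) {FF : Filter F} (h : T -> X) :
  std c -> chart_dom c x -> h u @[u --> F] --> proj x ->
  (\forall u \near F, simplex_prod R n (h u)) ->
  lsec c (h u) @[u --> F] --> lsec c (proj x).
Proof.
move=> cstd xc hx hs O.
rewrite (lsecE cstd)// => On.
pose k := chart_inv c \o (vabs \o chart_fun c).
have kc : {for x, continuous k}.
  apply: continuous_comp.
    apply: continuous_comp; first exact: chart_fun_cvg.
    exact: continuous_vabs.
  apply: (chart_inv_cvg cstd) => /=.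
  by apply: (cod_vabs cstd _).1; exact: chart_codP.
have A : nbhs x (k @^-1` O `&` chart_dom c).
  apply: filterI; first exact: kc.
  exact: (open_nbhs_nbhs (conj (open_dom cstd) xc)).
have := proj_nbhs A => /hx /= Bn.
apply: filterS2 hs Bn => u hu /(_ hu) [y [yO yc] e].
by rewrite /preimage /= -e (lsecE cstd).
Qed.

Lemma chart_fix c phi x t : std c ->
  (forall t x, chart_dom c x ->
    chart_fun c (act t x) = standard_act (phi t) (chart_fun c x)) ->
  chart_dom c x ->
  act t x = x <-> forall j, phi t 0 j = 0 \/ chart_fun c x 0 j = 0.
Proof.
move=> cstd; apply: standard_chart_fix; first exact: (chart_funK cstd).
by move=> s y; exact: dom_act.
Qed.

(** Over the interior no chart coordinate vanishes, so an orbit meets each open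
    orthant of a chart in at most one point. *)
Lemma proj_locally_injective x : zset (proj x) = finset.set0 ->
  exists2 O, nbhs x O & forall a b, O a -> O b -> proj a = proj b -> a = b.
Proof.
move=> px; have [c cstd xc] := sc_standard x.
have [phi _ h] := std_phi cstd.
have z0 j : chart_fun c x 0 j != 0.
  move: (zeros_chart cstd xc); rewrite px cards0 => /card0_eq /(_ j).
  by rewrite !inE => ->.
exists (chart_dom c `&`
  [set y | forall j, 0 < chart_fun c x 0 j * chart_fun c y 0 j]).
  apply: filterI; first exact: (open_nbhs_nbhs (conj (open_dom cstd) xc)).
  apply: filter_forall => j.
  have : chart_fun c x 0 j * chart_fun c y 0 j @[y --> x] -->
      chart_fun c x 0 j * chart_fun c x 0 j.
    apply: cvgM; first exact: cvg_cst.
    apply: (@continuous_comp _ _ _ (chart_fun c) (fun v => v 0 j)).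
      exact: (chart_fun_cvg cstd xc).
    exact: coord_continuous.
  move=> /cvgr_gt; apply; rewrite -expr2 exprn_even_gt0//=.
move=> a b [ac ap] [bc bp] /sc_proj_fib [t tb].
rewrite {}tb in bc bp *.
apply/esym/(chart_fix _ cstd h ac) => j; left.
move: (ap j) (bp j); rewrite h// standard_actE.
case: (F2_case (phi t 0 j)) => -> //; rewrite sgn1 mulN1r mulrN oppr_gt0 => p q.
by have := lt_trans p q; rewrite ltxx.
Qed.

End LocalStructure.

(** * Sections of the projection and rigidity *)

Section Separation.
Local Open Scope classical_set_scope.

Lemma cvg_neq_near (T : topologicalType) (U : Type) (F : set_system U)
    {FF : Filter F} (g h : U -> T) (a b : T) : hausdorff_space T ->
  g u @[u --> F] --> a -> h u @[u --> F] --> b -> a <> b ->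
  \forall u \near F, g u <> h u.
Proof.
rewrite open_hausdorff => hT ga hb /eqP /hT [[A B] /= [/set_mem Aa /set_mem Bb]].
move=> [oA oB /eqP AB].
have An := ga _ (open_nbhs_nbhs (conj oA Aa)).
have Bn := hb _ (open_nbhs_nbhs (conj oB Bb)).
near=> u => e.
have Au : A (g u) by near: u.
have Bu : B (h u) by near: u.
suff : set0 (g u) by [].
by rewrite -AB; split => //; rewrite e.
Unshelve. all: by end_near. Qed.

Lemma closed_equalizer (S T : topologicalType) (g h : S -> T) :
  hausdorff_space T -> continuous g -> continuous h ->
  closed [set x | g x = h x].
Proof.
move=> hT gc hc; rewrite -[X in closed X]setCK closedC openE => x /= gh.
exact: (@cvg_neq_near _ _ (nbhs x) _ g h (g x) (h x) hT (gc x) (hc x) gh).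
Qed.

End Separation.

Section Lifting.
Local Open Scope classical_set_scope.
Local Open Scope ring_scope.
Context {R : realType} {l : nat} {n : 'I_l -> nat} (M : small_cover R n).
Local Notation N := (\sum_(i < l) n i)%N.
Local Notation X := (simplex_prod_space R n).
Local Notation facet := {i : 'I_l & 'I_(n i).+1}.
Local Notation act := (@sc_act R l n M).
Local Notation proj := (@sc_proj R l n M).
Local Notation std := (standard_chart (@sc_atlas R l n M) act).
Implicit Types (c : chart R N M) (t : Z2 N).

(** Unique lifting of a path that stays in the interior until its endpoint: the
    lifts agree on an open set of times because the projection is locally
    injective there, and at the endpoint by continuity. *)
Lemma path_unique (g h : R -> M) (a b : R) : a < b ->
  (forall u, a <= u <= b ->
    g v @[v --> within `[a, b] (nbhs u)] --> g u /\
    h v @[v --> within `[a, b] (nbhs u)] --> h u) ->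
  (forall u, a <= u <= b -> proj (g u) = proj (h u)) ->
  (forall u, a <= u < b -> zset (proj (g u)) = finset.set0) ->
  g a = h a -> g b = h b.
Proof.
move=> ab ghc gh g0 gha.
have neq u : a <= u <= b -> g u <> h u ->
    \forall v \near u, a <= v <= b -> g v <> h v.
  move=> uab ne; have [gc hc] := ghc u uab.
  have H : \forall v \near u, (`[a, b]%classic : set R) v -> g v <> h v.
    exact: (cvg_neq_near (@sc_hausdorff R l n M) gc hc ne).
  by apply: filterS H => v hv vab; apply: hv; rewrite /= in_itv.
have eqab u : a <= u < b -> g u = h u.
  move=> uab.
  apply: (@connected_locally_constant _ `[a, b[ (fun v => g v = h v) _ _ a) => //.
  - apply/connected_intervalP; exact: interval_is_interval.
  - move=> v; rewrite /= in_itv /= => vab.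
    have vab' : a <= v <= b by case/andP: vab => -> /ltW ->.
    have [e|e] := pselect (g v = h v); last first.
      apply: filterS (neq v vab' e) => w hw; rewrite /= in_itv/= => /andP[aw wb].
      by split => // /hw; rewrite aw (ltW wb) => /(_ isT).
    have [U Ov Oinj] := proj_locally_injective (g0 v vab).
    have [gc hc] := ghc v vab'.
    have hO : nbhs (h v) U by rewrite -e.
    have A : \forall w \near v, (`[a, b]%classic : set R) w -> U (g w).
      exact: (gc _ Ov).
    have B : \forall w \near v, (`[a, b]%classic : set R) w -> U (h w).
      exact: (hc _ hO).
    apply: filterS2 A B => w gw hw; rewrite /= in_itv/= => /andP[aw wb].
    have wab : (`[a, b]%classic : set R) w by rewrite /= in_itv/= aw ltW.
    split=> // _; apply: Oinj; [exact: gw|exact: hw|].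
    by apply: gh; rewrite aw ltW.
  - by rewrite /= in_itv/= lexx.
apply: contrapT => ne.
have bab : a <= b <= b by rewrite lexx ltW.
have /nbhs_ballP [e /= e0 be] := neq b bab ne.
pose v := Num.max a (b - e / 2).
have vb : v < b by rewrite gt_max ab ltrBlDr ltrDl divr_gt0.
have av : a <= v by rewrite le_max lexx.
apply: (be v); last by apply: eqab; rewrite av.
  rewrite /ball /= gtr0_norm ?subr_gt0//.
  have : b - e / 2 <= v by rewrite le_max lexx orbT.
  move=> h1; have : e / 2 < e by rewrite ltr_pdivrMr// ltr_pMr// ltr1n.
  lra.
by rewrite av ltW.
Qed.

Section Lift.
Variables (Q : topologicalType) (h : Q -> X).
Hypotheses (Qco : compact [set: Q]) (hc : continuous h).
Hypothesis (hs : forall x, simplex_prod R n (h x)).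

Let p0 : X := face_center finset.set0.

Let p0P : simplex_prod R n p0 /\ zset p0 = finset.set0.
Proof. by apply: face_centerP => i; exists ord0; rewrite inE. Qed.

(* The contraction of the polytope to its barycentre. *)
Let H x u := segm p0 (h x) u.

Let H_simplex x u : 0 <= u <= 1 -> simplex_prod R n (H x u).
Proof. by move=> u01; apply: segm_simplex => //; exact: p0P.1. Qed.

Let H_interior x u : 0 <= u < 1 -> zset (H x u) = finset.set0.
Proof.
move=> /andP[u0 u1]; apply/setP => f; rewrite !inE bary_segm.
apply/negbTE; rewrite gt_eqF// ltr_pwDl//; last first.
  by rewrite mulr_ge0// bary_ge0.
rewrite mulr_gt0 ?subr_gt0// lt_neqAle bary_ge0 ?andbT; last exact: p0P.1.
have := p0P.2 => /setP /(_ f); rewrite !inE => /negbT.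
by rewrite eq_sym.
Qed.

(* During the time interval the path of [x] lies over the chart [c]. *)
Let covered c x a b := forall u, a <= u <= b ->
  exists2 y, chart_dom c y & proj y = H x u.

(* Compactness gives one mesh that serves all paths at all times. *)
Let subdivision : exists m : nat, forall k (x : Q), (k <= m)%N ->
  exists2 c, std c & \forall x' \near x,
    covered c x' (k%:R / m.+1%:R) (k.+1%:R / m.+1%:R).
Proof.
pose P (m : nat) (z : Q * R) := exists2 c, std c & \forall x' \near z.1,
  forall u, 0 <= u <= 1 -> `|z.2 - u| <= m.+1%:R^-1 ->
    exists2 y, chart_dom c y & proj y = H x' u.
have : compact ([set: Q] `*` (`[0, 1]%classic : set R)).
  by apply: compact_setX => //; exact: segment_compact.
move=> /compact_near_coveringP /(_ nat \oo P _).
case=> [[x t] [_ /=]|].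
  rewrite in_itv/= => t01.
  have [y yE] := proj_surj M (H_simplex x t01).
  have [c cstd yc] := sc_standard y.
  have := near_dom cstd yc; rewrite yE => /(@cvg_segm R l n Q p0 h x t hc).
  case=> [[A B] /= [Ax /nbhs_ballP [e /= e0 tB]] sAB].
  exists (A°%classic `*` ball t (e / 2), [set m : nat | m.+1%:R^-1 < e / 2]).
    split => /=; last first.
      have e20 : 0 < e / 2 by rewrite divr_gt0.
      exact: (near_infty_natSinv_lt (PosNum e20)).
    exists (A°%classic, ball t (e / 2)) => //; split => /=.
      exact: nbhs_interior.
    by apply: nbhsx_ballx; rewrite divr_gt0.
  move=> [[x' t'] m] /= [[Ax' tt'] me]; exists c => //=.
  apply: filterS Ax' => x'' Ax'' u u01 t'u.
  apply: (sAB (x'', u)) => /=; last exact: H_simplex.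
  split => //=; apply: tB; move: tt' t'u; rewrite /ball/= => h1 h2.
  have -> : t - u = (t - t') + (t' - u) by lra.
  rewrite (le_lt_trans (ler_normD _ _))// (splitr e) ltrD//.
  exact: (le_lt_trans h2).
move=> m _ Pm; exists m => k x km.
have m0 : 0 < m.+1%:R :> R by rewrite ltr0n.
have k01 : 0 <= (k%:R / m.+1%:R : R) <= 1.
  by rewrite divr_ge0 ?ler0n//= ler_pdivrMr// mul1r ler_nat leqW.
have kin : ([set: Q] `*` (`[0, 1]%classic : set R)) (x, k%:R / m.+1%:R).
  by split => //=; rewrite in_itv.
have [c cstd /= ch] := Pm m (leqnn m) _ kin.
exists c => //; apply: filterS ch => x' + u /andP[u1 u2]; apply => /=.
  rewrite (le_trans _ u1) ?(le_trans u2)// ?divr_ge0//.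
  by rewrite ler_pdivrMr// mul1r ler_nat ltnS.
rewrite ler0_norm ?subr_le0// opprB lerBlDr (le_trans u2)//.
by rewrite -natr1 mulrDl mul1r addrC.
Qed.

Let lifts (a : R) (F : Q -> M) := [/\ continuous F,
  forall x, proj (F x) = H x a & forall x y, h x = h y -> F x = F y].

(* [z] is the endpoint of the lift, starting at [w], of the path followed by
   [x] from time [a] to time [b]. *)
Let moved a b x (w z : M) := exists c g, [/\ std c, covered c x a b,
  w = act g (lsec c (H x a)) & z = act g (lsec c (H x b))].

Let covered_proj c x a b u : std c -> covered c x a b -> a <= u <= b ->
  proj (lsec c (H x u)) = H x u.
Proof. by move=> cstd ch /ch [y yc <-]; rewrite proj_lsec. Qed.

Let covered_cvg c x a b g u : 0 <= a -> b <= 1 -> std c -> covered c x a b ->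
  a <= u <= b ->
  act g (lsec c (H x v)) @[v --> within `[a, b] (nbhs u)] -->
    act g (lsec c (H x u)).
Proof.
move=> a0 b1 cstd ch uab; have [y yc yu] := ch u uab.
apply: (continuous_cvg _ (@continuous_act _ _ _ M g _)).
rewrite -yu; apply: (lsec_cvg cstd yc).
  rewrite yu; apply: cvg_within_filter; exact: continuous_segm.
rewrite near_withinE; apply: nearW => v; rewrite /= in_itv/= => /andP[av vb].
by apply: H_simplex; rewrite (le_trans a0 av) (le_trans vb b1).
Qed.

(* The endpoint does not depend on the chart, as the path only reaches the
   boundary of the polytope at its very end. *)
Let moved_unique a b x w z z' : 0 <= a < b -> b <= 1 ->
  moved a b x w z -> moved a b x w z' -> z = z'.
Proof.
move=> /andP[a0 ab] b1 [c [g [cstd ch -> ->]]] [c' [g' [cstd' ch' e ->]]].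
apply: (path_unique (g := fun u => act g (lsec c (H x u)))
  (h := fun u => act g' (lsec c' (H x u))) ab) => // u uab.
- by split; apply: covered_cvg.
- by rewrite !proj_act (covered_proj cstd ch uab) (covered_proj cstd' ch' uab).
- rewrite proj_act; have uab' : a <= u <= b by case/andP: uab => -> /ltW ->.
  rewrite (covered_proj cstd ch uab') H_interior//.
  by case/andP: uab => /(le_trans a0) -> /= ub; rewrite (lt_le_trans ub).
Qed.

Let moved_exists a b c x w : a <= b -> std c -> covered c x a b ->
  proj w = H x a ->
  exists g, w = act g (lsec c (H x a)) /\
    moved a b x w (act g (lsec c (H x b))).
Proof.
move=> ab cstd ch wa; 
have /esym/sc_proj_fib [g gE] : proj w = proj (lsec c (H x a)).
  by rewrite (covered_proj cstd ch)// lexx.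
by exists g; split=> //; exists c, g.
Qed.

Let lift_step a b F : 0 <= a < b -> b <= 1 ->
  (forall x : Q, exists2 c, std c & \forall x' \near x, covered c x' a b) ->
  lifts a F -> exists F', lifts b F'.
Proof.
move=> /[dup] a0b /andP[a0 ab] b1 cov [Fc Fp Fh].
have ex x : exists z, moved a b x (F x) z.
  have [c cstd /nbhs_singleton ch] := cov x.
  have [g [_ mg]] := moved_exists (ltW ab) cstd ch (Fp x).
  by exists (act g (lsec c (H x b))).
pose F' x := sval (cid (ex x)).
have F'P x : moved a b x (F x) (F' x) by rewrite /F'; case: cid.
exists F'; split=> [x|x|x y hxy].
- have [c cstd chn] := cov x; have ch := nbhs_singleton chn.
  have [g [gE mg]] := moved_exists (ltW ab) cstd ch (Fp x).
  have cv u : a <= u <= b ->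
      act g (lsec c (H x' u)) @[x' --> x] --> act g (lsec c (H x u)).
    move=> uab; have [y yc yu] := ch u uab.
    apply: (continuous_cvg _ (@continuous_act _ _ _ M g _)).
    rewrite -yu; apply: (lsec_cvg cstd yc).
      rewrite yu.
      exact: continuous_segm_end.
    apply: nearW => v; apply: H_simplex.
    by case/andP: uab => /(le_trans a0) -> /= ub; rewrite (le_trans ub b1).
  have aab : a <= a <= b by rewrite lexx ltW.
  have bab : a <= b <= b by rewrite lexx ltW.
  have Fint : zset (proj (F x)) = finset.set0.
    by rewrite Fp H_interior// a0 (lt_le_trans ab).
  have [U OF Oinj] := proj_locally_injective Fint.
  have e : \forall x' \near x, act g (lsec c (H x' b)) = F' x'.
    have A : nbhs x (F @^-1` U) by exact: Fc.
    have B : nbhs x ((fun x' => act g (lsec c (H x' a))) @^-1` U).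
      have UF : nbhs (act g (lsec c (H x a))) U by rewrite -gE.
      exact: (cv a aab U UF).
    apply: filterS (filterI A (filterI B chn)) => x' [{}A [{}B C]].
    apply: (moved_unique a0b b1 _ (F'P x')).
    exists c, g; split => //; apply: Oinj => //.
    by rewrite proj_act Fp (covered_proj cstd C aab).
  rewrite /continuous_at -(nbhs_singleton e).
  by apply: cvg_trans (near_eq_cvg e) _; exact: cv.
- have [c [g [cstd ch _ ->]]] := F'P x.
  by rewrite proj_act (covered_proj cstd ch)// lexx ltW.
- apply: (moved_unique a0b b1 (F'P x)).
  by rewrite /moved /covered /H hxy (Fh _ _ hxy); exact: F'P.
Qed.

(** The contraction of the polytope is lifted step by step along the subdivision;
    its last stage lifts [h]. *)
Lemma lift_exists : exists S : Q -> M, [/\ continuous S,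
  forall x, proj (S x) = h x & forall x y, h x = h y -> S x = S y].
Proof.
have [m cov] := subdivision.
have m0 : 0 < m.+1%:R :> R by rewrite ltr0n.
suff /(_ m.+1) [//|F [Fc Fp Fh]] : forall k, (k <= m.+1)%N ->
    exists F, lifts (k%:R / m.+1%:R) F.
  exists F; split=> // x; rewrite Fp divff ?gt_eqF//.
  exact: segm1.
elim=> [_|k IH km].
  have [m1 m1E] := proj_surj M p0P.1.
  exists (fun=> m1); split => [x|x|//]; first exact: cvg_cst.
  by rewrite mul0r /H segm0.
have [F FP] := IH (ltnW km).
apply: (lift_step _ _ _ FP).
- by rewrite divr_ge0 ?ler0n//= ltr_pM2r ?invr_gt0// ltr_nat.
- by rewrite ler_pdivrMr// mul1r ler_nat.
- by move=> x; exact: cov.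
Qed.

End Lift.

(** The lift of the projection itself is constant on the orbits, hence is a
    section composed with the projection; the section is continuous because the
    projection is open. Continuity on the polytope is expressed by composing
    with maps into it. *)
Lemma section_exists : exists s : X -> M,
  (forall q, simplex_prod R n q -> proj (s q) = q) /\
  (forall (Q : topologicalType) (h : Q -> X), continuous h ->
    (forall x, simplex_prod R n (h x)) -> continuous (s \o h)).
Proof.
have [S [Sc Sp Sh]] := lift_exists (@sc_compact R l n M)
  (@sc_proj_cont R l n M) (@proj_simplex _ _ _ M).
have [|c0P _] := @face_centerP R l n finset.set0.
  by move=> i; exists ord0; rewrite inE.
have [x0 _] := proj_surj M c0P.
pose s q := S (xget x0 [set x | proj x = q]).
have sE x : s (proj x) = S x.
  rewrite /s; case: xgetP => [y _ /Sh //|/(_ x)]; by case.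
exists s; split=> [q /(proj_surj M) [x <-]|Q h hc hs x O]; first by rewrite sE.
have [y yx] := proj_surj M (hs x); rewrite /= -yx sE => SO.
have Oy : nbhs y (S @^-1` O) by exact: Sc.
have := proj_nbhs Oy; rewrite yx => Ny.
have B : \forall z \near x, simplex_prod R n (h z) ->
    exists2 w, (S @^-1` O) w & proj w = h z by exact: (hc x _ Ny).
apply: filterS B => z /(_ (hs z)) [w wO] /= wz.
by rewrite /preimage /= -wz sE.
Qed.

End Lifting.

Section Rigidity.
Local Open Scope classical_set_scope.
Local Open Scope ring_scope.
Context {R : realType} {l : nat} {n : 'I_l -> nat}.
Local Notation N := (\sum_(i < l) n i)%N.
Local Notation X := (simplex_prod_space R n).

(** A point is a translate of the value of the section in its orbit, by a group
    element that is unique up to isotropy and need not vary continuously; but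
    the preimage of a closed set is the finite union over all group elements of
    closed sets. *)
Lemma equivariant_extension (M1 M2 : small_cover R n)
    (s1 : X -> M1) (s2 : X -> M2) (phi : {additive Z2 N -> Z2 N}) :
  (forall q, simplex_prod R n q -> sc_proj (s1 q) = q) ->
  (forall q, simplex_prod R n q -> sc_proj (s2 q) = q) ->
  continuous (s1 \o @sc_proj R l n M1) ->
  continuous (s2 \o @sc_proj R l n M1) ->
  (forall (x : M1) (y : M2) t, sc_proj x = sc_proj y ->
    sc_act t x = x -> sc_act (phi t) y = y) ->
  exists2 f : M1 -> M2, continuous f &
    forall (x : M1) t, f (sc_act t (s1 (sc_proj x))) =
      sc_act (phi t) (s2 (sc_proj x)).
Proof.
move=> s1p s2p s1c s2c iso.
have ex (x : M1) : exists y : M2, exists2 t, x = sc_act t (s1 (sc_proj x)) &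
    y = sc_act (phi t) (s2 (sc_proj x)).
  have /sc_proj_fib [t tE] : sc_proj (s1 (sc_proj x)) = sc_proj x.
    by rewrite s1p//; exact: proj_simplex.
  by exists (sc_act (phi t) (s2 (sc_proj x))), t.
pose f (x : M1) := sval (cid (ex x)).
have fP (x : M1) : exists2 t, x = sc_act t (s1 (sc_proj x)) &
    f x = sc_act (phi t) (s2 (sc_proj x)) by rewrite /f; case: cid.
have fE (x : M1) t : x = sc_act t (s1 (sc_proj x)) ->
    f x = sc_act (phi t) (s2 (sc_proj x)).
  move=> xt; have [t' xt' ->] := fP x.
  have sP := proj_simplex x.
  have fixt : sc_act (t' + t) (s1 (sc_proj x)) = s1 (sc_proj x).
    by rewrite sc_actD -xt xt' proj_act s1p// actK.
  have := iso (s1 (sc_proj x)) (s2 (sc_proj x)) _ _ fixt.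
  rewrite s1p// s2p// => /(_ erefl) h.
  by rewrite -{2}h raddfD addrC sc_actD actK.
exists f; last first.
  move=> x t; have e : sc_proj (sc_act t (s1 (sc_proj x))) = sc_proj x.
    by rewrite proj_act s1p//; exact: proj_simplex.
  by rewrite (fE _ t) e.
apply/continuous_closedP => C cC.
have -> : f @^-1` C = \bigcup_(t in [set: Z2 N])
    ([set x | x = sc_act t ((s1 \o @sc_proj R l n M1) x)] `&`
     (fun x => sc_act (phi t) ((s2 \o @sc_proj R l n M1) x)) @^-1` C).
  rewrite eqEsubset; split=> [x /= fx|x [t _ [/= xt]]].
    have [t xt ft] := fP x; exists t => //; split => //=.
    by rewrite /preimage /= -ft.
  by rewrite /preimage /= (fE _ _ xt).
apply: closed_bigcup; first exact: finite_finset.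
move=> t _; apply: closedI.
  apply: closed_equalizer; first exact: sc_hausdorff.
    by move=> x; exact: cvg_id.
  move=> x; apply: (continuous_comp (s1c x)); exact: continuous_act.
move/continuous_closedP: (fun x => continuous_comp (s2c x)
  (@continuous_act _ _ _ M2 (phi t) _)); exact.
Qed.

Lemma DJ_equiv_of_isotropy (M1 M2 : small_cover R n)
    (phi : {additive Z2 N -> Z2 N}) : bijective phi ->
  (forall (x : M1) (y : M2) t, sc_proj x = sc_proj y ->
    sc_act t x = x <-> sc_act (phi t) y = y) ->
  DJ_equiv M1 M2.
Proof.
move=> phib iso.
have [psi [phiK psiK]] := additive_inverse phib.
have [s1 [s1p s1c]] := section_exists M1.
have [s2 [s2p s2c]] := section_exists M2.
have pc1 := @sc_proj_cont R l n M1; have ps1 := @proj_simplex _ _ _ M1.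
have pc2 := @sc_proj_cont R l n M2; have ps2 := @proj_simplex _ _ _ M2.
have [|f fc fE] := equivariant_extension (phi := phi) s1p s2p
    (s1c _ _ pc1 ps1) (s2c _ _ pc1 ps1).
  by move=> x y t xy /(iso _ _ _ xy).
have [|g gc gE] := equivariant_extension (phi := psi) s2p s1p
    (s2c _ _ pc2 ps2) (s1c _ _ pc2 ps2).
  by move=> x y t xy tx; apply/(iso _ _ _ (esym xy)); rewrite /= psiK.
have s1E (x : M1) : exists t, x = sc_act t (s1 (sc_proj x)).
  by apply/sc_proj_fib; rewrite s1p.
have s2E (x : M2) : exists t, x = sc_act t (s2 (sc_proj x)).
  by apply/sc_proj_fib; rewrite s2p.
have fp x : sc_proj (f x) = sc_proj x.
  by have [t {1}->] := s1E x; rewrite fE proj_act s2p.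
have gp x : sc_proj (g x) = sc_proj x.
  by have [t {1}->] := s2E x; rewrite gE proj_act s1p.
exists phi, f, g; split => //.
- split => //.
    move=> x; have [t xt] := s1E x; have [t' xt'] := s2E (f x).
    rewrite xt fE -(fp x) gE /= phiK fp -xt.
    by [].
  move=> y; have [t yt] := s2E y.
  rewrite yt gE -(gp y) fE /= psiK gp -yt.
  by [].
move=> t x; have [t' xt] := s1E x.
by rewrite xt -sc_actD !fE raddfD sc_actD.
Qed.

End Rigidity.

(** * Characteristic vectors and their normal form *)

Section Characteristic.
Local Open Scope ring_scope.
Context {l : nat} {n : 'I_l -> nat}.
Local Notation N := (\sum_(i < l) n i)%N.
Local Notation facet := {i : 'I_l & 'I_(n i).+1}.
Local Notation fct i j := (existT (fun k : 'I_l => 'I_(n k).+1) i j).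
Local Notation cell i j := (@tagnat.rank l n (existT (fun k : 'I_l => 'I_(n k)) i j)).
Implicit Types (w : facet -> 'F_2) (lam : facet -> Z2 N) (A : 'M['F_2]_(l, N)).

(** Facet colourings [w] are read as formal sums of facets modulo 2. *)
Definition comb lam w : Z2 N := \sum_f w f *: lam f.

(** Vectors assigned to the facets are nonsingular when those of the facets
    through any vertex, i.e. any family containing no full factor, are
    linearly independent. *)
Definition nonsingular lam := forall w, comb lam w = 0 ->
  (forall i : 'I_l, exists j, w (fct i j) = 0) -> forall f, w f = 0.

(** The facets through the vertex with index [0] in each factor get the
    standard basis, and the remaining facet of the [i]-th factor gets the
    [i]-th row of [A]. *)
Definition lamA A (f : facet) : Z2 N :=
  if unlift ord0 (tagged f) is Some j then delta_mx 0 (cell (tag f) j)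
  else row (tag f) A.

(** The two complementary pieces of the space of facet colourings: the
    relations between the vectors [lamA A], indexed by their values on the
    facets of index [0], and the colourings vanishing on these facets. *)
Definition eps A (u : 'rV['F_2]_l) (f : facet) : 'F_2 :=
  if unlift ord0 (tagged f) is Some j then (u *m A) 0 (cell (tag f) j)
  else u 0 (tag f).

Definition del (t : Z2 N) (f : facet) : 'F_2 :=
  if unlift ord0 (tagged f) is Some j then t 0 (cell (tag f) j) else 0.

(** The sign changes given by the nonzero relations are to act without fixed
    points on the product of the unit spheres: each of them must change the
    signs of all coordinates of some factor. *)
Definition good A := forall u, u != 0 ->
  exists i : 'I_l, forall j, eps A u (fct i j) = 1.

Lemma facetW (P : facet -> Prop) :
  (forall i, P (fct i ord0)) -> (forall i j, P (fct i (lift ord0 j))) ->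
  forall f, P f.
Proof.
by move=> P0 P1 [i j]; case: (unliftP ord0 j) => [k ->|->].
Qed.

Lemma facet_avoid (f : facet) i : (0 < n i)%N -> exists j, fct i j != f.
Proof.
move=> n0; have [e|] := eqVneq (fct i ord0) f; last by exists ord0.
exists ord_max; rewrite -e; apply/eqP => /eqP; rewrite eq_Tagged /=.
by rewrite -val_eqE /= -leqn0 leqNgt n0.
Qed.

Lemma eps_ord0 A u i : eps A u (fct i ord0) = u 0 i.
Proof. by rewrite /eps /= unlift_none. Qed.
Lemma eps_lift A u i j :
  eps A u (fct i (lift ord0 j)) = (u *m A) 0 (cell i j).
Proof. by rewrite /eps /= liftK. Qed.
Lemma del_ord0 t i : del t (fct i ord0) = 0.
Proof. by rewrite /del /= unlift_none. Qed.
Lemma del_lift t i j : del t (fct i (lift ord0 j)) = t 0 (cell i j).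
Proof. by rewrite /del /= liftK. Qed.
Lemma lamA_ord0 A i : lamA A (fct i ord0) = row i A.
Proof. by rewrite /lamA /= unlift_none. Qed.
Lemma lamA_lift A i j : lamA A (fct i (lift ord0 j)) = delta_mx 0 (cell i j).
Proof. by rewrite /lamA /= liftK. Qed.

Lemma epsD A u v f : eps A (u + v) f = eps A u f + eps A v f.
Proof.
by move: f; apply: facetW => i *; rewrite ?eps_ord0 ?eps_lift ?mulmxDl !mxE.
Qed.

Lemma eps0 A f : eps A 0 f = 0.
Proof.
by move: f; apply: facetW => i *; rewrite ?eps_ord0 ?eps_lift ?mul0mx !mxE.
Qed.

Lemma delD s t f : del (s + t) f = del s f + del t f.
Proof.
by move: f; apply: facetW => i *; rewrite ?del_ord0 ?del_lift ?mxE ?addr0.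
Qed.

Lemma row_cellP (T : Type) (s t : 'rV[T]_N) :
  (forall i j, s 0 (cell i j) = t 0 (cell i j)) -> s = t.
Proof.
move=> h; apply/rowP => a; rewrite -(tagnat.sigK a).
by case: (tagnat.sig a) => i j; exact: h.
Qed.

Lemma sum_facet (V : nmodType) (F : facet -> V) :
  \sum_f F f = \sum_i \sum_j F (fct i j).
Proof. by rewrite sig_big_dep /=; apply: eq_bigr => -[]. Qed.

Lemma combE A w i j : comb (lamA A) w 0 (cell i j) =
  w (fct i (lift ord0 j)) + ((\row_k w (fct k ord0)) *m A) 0 (cell i j).
Proof.
rewrite /comb summxE sum_facet.
under eq_bigr do rewrite big_ord_recl.
rewrite big_split/= addrC; congr (_ + _); last first.
  rewrite mxE; apply: eq_bigr => k _.
  by rewrite lamA_ord0 !mxE.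
rewrite (bigD1 i)//= [X in _ + X]big1 ?addr0; last first.
  move=> k ki; rewrite big1// => m _; rewrite lamA_lift !mxE/=.
  rewrite (inj_eq (can_inj (@tagnat.rankK _ _))) -tag_eqE/= /tag_eq /=.
  by rewrite eq_sym (negbTE ki) mulr0.
rewrite (bigD1 j)//= [X in _ + X]big1 ?addr0; last first.
  move=> k kj; rewrite lamA_lift !mxE/=.
  rewrite (inj_eq (can_inj (@tagnat.rankK _ _))) -tag_eqE/= /tag_eq /=.
  by rewrite eqxx/= tagged_asE eq_sym (negbTE kj) mulr0.
by rewrite lamA_lift !mxE !eqxx mulr1.
Qed.

Lemma comb_eps A u : comb (lamA A) (eps A u) = 0.
Proof.
apply: row_cellP => i j; rewrite combE eps_lift [RHS]mxE.
have -> : \row_k eps A u (fct k ord0) = u.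
  by apply/rowP => k; rewrite mxE eps_ord0.
exact: F2_addxx.
Qed.

Lemma comb_del A t : comb (lamA A) (del t) = t.
Proof.
apply: row_cellP => i j; rewrite combE del_lift.
have -> : \row_k del t (fct k ord0) = 0.
  by apply/rowP => k; rewrite !mxE del_ord0.
by rewrite mul0mx [X in _ + X]mxE addr0.
Qed.

(** Used to trade a sign change for the group element that it represents, at the
    cost of a relation. *)
Lemma colouring_split A w f :
  w f = del (comb (lamA A) w) f + eps A (\row_i w (fct i ord0)) f.
Proof.
move: f; apply: facetW => [i|i j].
  by rewrite del_ord0 eps_ord0 add0r mxE.
by rewrite del_lift eps_lift combE -addrA F2_addxx addr0.
Qed.

Lemma combD lam w w' : comb lam (fun f => w f + w' f) = comb lam w + comb lam w'.
Proof. by rewrite /comb -big_split; apply: eq_bigr => f _; rewrite scalerDl. Qed.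

Lemma comb_ext lam w w' : w =1 w' -> comb lam w = comb lam w'.
Proof. by move=> h; apply: eq_bigr => f _; rewrite h. Qed.

(** Both conditions exclude nonzero relations that vanish somewhere on each
    factor. *)
Lemma good_nonsingular A : good A <-> nonsingular (lamA A).
Proof.
split=> [gA w w0 wz f|ns u u0].
  have wE g : w g = eps A (\row_i w (fct i ord0)) g.
    rewrite {1}(colouring_split A w g) w0.
    have -> : del 0 g = 0; last by rewrite add0r.
    by move: g; apply: facetW => *; rewrite ?del_ord0 ?del_lift ?mxE.
  have [u0|/gA [i hi]] := eqVneq (\row_i w (fct i ord0)) 0.
    by rewrite wE u0 eps0.
  have [j] := wz i; rewrite wE hi => /eqP.
  by rewrite oner_eq0.
apply: contrapT => nex; move/negP: u0; apply.
suff e0 : forall f, eps A u f = 0.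
  by apply/eqP/rowP => i; rewrite mxE -(eps_ord0 A).
apply: ns; first exact: comb_eps.
move=> i; apply: contrapT => nj; apply: nex; exists i => j.
case: (F2_case (eps A u (fct i j))) => // e.
by exfalso; apply: nj; exists j.
Qed.

Lemma comb_raddf (phi : {additive Z2 N -> Z2 N}) lam w :
  phi (comb lam w) = comb (phi \o lam) w.
Proof.
rewrite raddf_sum; apply: eq_bigr => f _ /=.
by case: (F2_case (w f)) => ->; rewrite ?scale0r ?raddf0 ?scale1r.
Qed.

(** The vectors of the facets of nonzero index form a basis, since no factor is
    among these facets; the automorphism is the change to the standard basis. *)
Lemma normal_form lam : nonsingular lam ->
  exists A (phi : {additive Z2 N -> Z2 N}),
    [/\ good A, bijective phi & forall f, phi (lam f) = lamA A f].
Proof.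
move=> ns; pose psi t := comb lam (del t).
have psiD s t : psi (s + t) = psi s + psi t.
  by rewrite /psi -combD; apply: comb_ext => f; rewrite delD.
have psi_inj : injective psi.
  move=> s t /eqP; rewrite -subr_eq0 -[- psi t]Z2_opp opprK -psiD => /eqP st0.
  have h : forall f, del (s + t) f = 0.
    by apply: ns => // i; exists ord0; rewrite del_ord0.
  have st : s + t = 0.
    by apply: row_cellP => i j; rewrite -del_lift h mxE.
  by apply/eqP; rewrite -subr_eq0 -[- t]Z2_opp opprK st.
have [phi psiK phiK] := injF_bij psi_inj.
have phiD : zmod_morphism phi.
  move=> s t; apply: psi_inj; rewrite phiK -[- phi t]Z2_opp opprK psiD !phiK.
  by rewrite -[- t]Z2_opp opprK.
pose phiA : {additive Z2 N -> Z2 N} :=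
  HB.pack phi (GRing.isZmodMorphism.Build _ _ _ phiD).
pose A : 'M['F_2]_(l, N) := \matrix_(i < l) phi (lam (fct i ord0)).
have phiE f : phiA (lam f) = lamA A f.
  move: f; apply: facetW => [i|i j].
    by rewrite lamA_ord0 rowK.
  rewrite lamA_lift; apply: psi_inj; rewrite /= phiK /psi /comb.
  rewrite (bigD1 (fct i (lift ord0 j)))//= [X in _ + X]big1 ?addr0.
    by rewrite del_lift mxE !eqxx scale1r.
  apply: facetW => [k _|k m]; first by rewrite del_ord0 scale0r.
  move=> ne; rewrite del_lift mxE/= (inj_eq (can_inj (@tagnat.rankK _ _))).
  case: eqP => [e|_]; last by rewrite scale0r.
  case/eqP: ne.
  exact: (congr1 (fun b => fct (tag b) (lift ord0 (tagged b))) e).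
exists A, phiA; split => //; last by exists psi.
apply/good_nonsingular => w.
have -> : comb (lamA A) w = phiA (comb lam w).
  by rewrite comb_raddf; apply: eq_bigr => f _ /=; rewrite -phiE.
move=> /(congr1 psi); rewrite /= phiK.
have -> : psi 0 = 0 by rewrite -[0 in LHS](raddf0 phiA) /= phiK.
exact: ns.
Qed.

(** Both numbers are the base 2 logarithm of the order of one group, at once a
    coordinate subspace and freely spanned by the vectors of the facets in [D]. *)
Lemma card_coordinates lam (phi : {additive Z2 N -> Z2 N})
    (J : {set 'I_N}) (D : {set facet}) : bijective phi ->
  (forall t, (forall j, phi t 0 j = 0 \/ j \in J) <->
    exists2 w, forall f, w f = 0 \/ f \in D & t = comb lam w) ->
  (forall w, (forall f, w f = 0 \/ f \in D) -> comb lam w = 0 ->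
    forall f, w f = 0) ->
  #|J| = #|D|.
Proof.
move=> phib span free; have [psi [phiK psiK]] := additive_inverse phib.
pose ind (S : {set facet}) f : 'F_2 := (f \in S)%:R.
have indD (S : {set facet}) : S \subset D -> forall f, ind S f = 0 \/ f \in D.
  move=> /fintype.subsetP SD f; rewrite /ind.
  by case: (boolP (f \in S)) => [/SD|]; [right|left].
pose im S := [set j | phi (comb lam (ind S)) 0 j != 0]%SET.
have im_inj : {in powerset D &, injective im}.
  move=> S S'; rewrite !powersetE => SD SD' /setP e.
  have {}e : comb lam (ind S) = comb lam (ind S').
    apply: (can_inj phiK); apply/rowP => j; have := e j; rewrite !inE.
    exact: F2_inj.
  have h : forall f, ind S f + ind S' f = 0.
    apply: free; last by rewrite combD e Z2_addxx.
    move=> f; have [fD|fD] := boolP (f \in D); [by right|left].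
    have [->|] := indD S SD f; last by rewrite (negbTE fD).
    have [->|] := indD S' SD' f; last by rewrite (negbTE fD).
    by rewrite addr0.
  apply/setP => f; have := h f; rewrite /ind.
  by case: (f \in S); case: (f \in S').
have imE : [set im S | S in powerset D]%SET = powerset J.
  apply/setP => K; rewrite powersetE; apply/imsetP/idP => [[S]|/fintype.subsetP KJ].
    rewrite powersetE => SD ->; apply/fintype.subsetP => j; rewrite inE => j0.
    have /span /(_ j) [e|//] : exists2 w, forall f, w f = 0 \/ f \in D &
        comb lam (ind S) = comb lam w by exists (ind S) => //; exact: indD.
    by rewrite e eqxx in j0.
  pose s : Z2 N := \row_j (j \in K)%:R.
  have [w wD sE] : exists2 w, forall f, w f = 0 \/ f \in D & psi s = comb lam w.
    apply/span => j; rewrite psiK mxE.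
    by case: (boolP (j \in K)) => [/KJ|]; [right|left].
  exists [set f | w f != 0]%SET.
    rewrite powersetE; apply/fintype.subsetP => f; rewrite inE.
    by have [->|//] := wD f; rewrite eqxx.
  apply/setP => j; rewrite inE.
  have -> : comb lam (ind [set f | w f != 0]%SET) = comb lam w.
    by apply: comb_ext => f; rewrite /ind inE; case: (F2_case (w f)) => ->.
  rewrite -sE psiK mxE.
  by case: (j \in K); rewrite ?oner_eq0 ?eqxx.
have : (2 ^ #|J| = 2 ^ #|D|)%N by rewrite -!card_powerset -imE card_in_imset.
exact: expnI.
Qed.

End Characteristic.

(** * Isotropy groups of a small cover *)

Section Isotropy.
Local Open Scope classical_set_scope.
Local Open Scope ring_scope.
Context {R : realType} {l : nat} {n : 'I_l -> nat} (M : small_cover R n).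
Hypothesis n_gt0 : forall i, (0 < n i)%N.
Local Notation N := (\sum_(i < l) n i)%N.
Local Notation X := (simplex_prod_space R n).
Local Notation facet := {i : 'I_l & 'I_(n i).+1}.
Local Notation fct i j := (existT (fun k : 'I_l => 'I_(n k).+1) i j).
Local Notation act := (@sc_act R l n M).
Local Notation proj := (@sc_proj R l n M).
Local Notation std := (standard_chart (@sc_atlas R l n M) act).
Implicit Types (c : chart R N M) (x y : M) (t : Z2 N) (f : facet).

Lemma facet_centerP f :
  simplex_prod R n (face_center [set f]%SET) /\
  zset (face_center [set f]%SET : X) = [set f]%SET.
Proof.
apply: face_centerP => i.
have [j jf] := facet_avoid f (n_gt0 i).
by exists j; rewrite inE.
Qed.

Lemma fix_same_orbit x y t : proj x = proj y -> act t x = x -> act t y = y.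
Proof.
move=> /sc_proj_fib [s ->] tx.
by rewrite -sc_actD addrC sc_actD tx.
Qed.

Lemma codim1_zero c x f : std c -> chart_dom c x ->
  zset (proj x) = [set f]%SET ->
  exists2 a, chart_fun c x 0 a = 0 & forall b, b != a -> chart_fun c x 0 b != 0.
Proof.
move=> cstd xc xf; have := zeros_chart cstd xc; rewrite xf cards1 zerosE => /eqP.
move=> /cards1P [a /setP aE].
have h b : (chart_fun c x 0 b == 0) = (b == a).
  by have := aE b; rewrite !inE.
exists a; first by apply/eqP; rewrite h.
by move=> b; rewrite h.
Qed.

Lemma near_nonzero c x : std c -> chart_dom c x ->
  \forall y \near x, chart_dom c y /\
    forall b, chart_fun c x 0 b != 0 -> chart_fun c y 0 b != 0.
Proof.
move=> cstd xc; apply: filterI.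
  exact: (open_nbhs_nbhs (conj (open_dom cstd) xc)).
apply: filter_forall => b.
have [e|xb] := eqVneq (chart_fun c x 0 b) 0.
  by apply: nearW.
have cb : chart_fun c y 0 b @[y --> x] --> chart_fun c x 0 b.
  apply: (@continuous_comp _ _ _ (chart_fun c) (fun v => v 0 b)).
    exact: (chart_fun_cvg cstd xc).
  exact: coord_continuous.
have H : \forall y \near x, chart_fun c y 0 b != 0.
  exact: (@cvgr_neq0 R R _ _ _ _ _ cb xb).
have H' : \forall y \near x, ~~ false -> chart_fun c y 0 b != 0.
  by apply: filterS H => y yb _.
exact: H'.
Qed.

Lemma codim1_fix c phi x t a : std c ->
  (forall t x, chart_dom c x ->
    chart_fun c (act t x) = standard_act (phi t) (chart_fun c x)) ->
  chart_dom c x -> chart_fun c x 0 a = 0 ->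
  (forall b, b != a -> chart_fun c x 0 b != 0) ->
  act t x = x <-> forall b, b != a -> phi t 0 b = 0.
Proof.
move=> cstd h xc xa xb; rewrite (chart_fix t cstd h xc); split=> [hb b ba|hb b].
  by have [//|/eqP] := hb b; rewrite (negbTE (xb b ba)).
by have [->|/hb ->] := eqVneq b a; [right|left].
Qed.

Lemma segm_zset_same p q f u : 0 <= u <= 1 ->
  simplex_prod R n p -> simplex_prod R n q ->
  zset p = [set f]%SET -> zset q = [set f]%SET ->
  zset (segm p q u) = [set f]%SET.
Proof.
move=> /andP[u0 u1] ps qs /setP pf /setP qf; apply/setP => g.
move: (pf g) (qf g) (bary_ge0 g ps) (bary_ge0 g qs).
rewrite !inE bary_segm; have [_ /eqP-> /eqP-> _ _|_ pg qg p0 q0] := eqVneq g f.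
  by rewrite !mulr0 addr0 eqxx.
have pp : 0 < bary p g by rewrite lt_neqAle p0 eq_sym pg.
have qq : 0 < bary q g by rewrite lt_neqAle q0 eq_sym qg.
apply/negbTE; rewrite gt_eqF//.
have [->|u0'] := eqVneq u 0; first by rewrite subr0 mul1r mul0r addr0.
apply: ltr_wpDl; first by rewrite mulr_ge0// subr_ge0.
by rewrite mulr_gt0// lt_neqAle u0 eq_sym u0'.
Qed.

(** The relative interior of a facet is convex, and near one of its points the
    coordinate that vanishes in a chart remains the same. *)
Lemma codim1_fix_constant f x y t :
  zset (proj x) = [set f]%SET -> zset (proj y) = [set f]%SET ->
  act t x = x -> act t y = y.
Proof.
move=> xf yf tx.
pose P u := exists2 z, proj z = segm (proj x) (proj y) u & act t z = z.
suff [z zy tz] : P 1.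
  by apply: fix_same_orbit tz; rewrite zy segm1.
have sx := proj_simplex x; have sy := proj_simplex y.
apply: (@connected_locally_constant _ (`[0, 1]%classic : set R) P _ _ 0).
- exact: segment_connected.
- move=> u; rewrite /= in_itv/= => u01.
  have [z zE] := proj_surj M (segm_simplex u01 sx sy).
  have zf : zset (proj z) = [set f]%SET by rewrite zE; exact: segm_zset_same.
  have [c cstd zc] := sc_standard z; have [phi _ h] := std_phi cstd.
  have [a za zb] := codim1_zero cstd zc zf.
  have B := proj_nbhs (near_nonzero cstd zc); rewrite zE in B.
  have {}B : \forall v \near u, simplex_prod R n (segm (proj x) (proj y) v) ->
      exists2 w, chart_dom c w /\ (forall b, chart_fun c z 0 b != 0 ->
        chart_fun c w 0 b != 0) & proj w = segm (proj x) (proj y) v.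
    by have := @continuous_segm _ _ _ (proj x) (proj y) u _ B.
  apply: filterS B => v Bv; rewrite /= in_itv/= => v01.
  have [w [wc wz] wE] := Bv (segm_simplex v01 sx sy).
  have wf : zset (proj w) = [set f]%SET by rewrite wE; exact: segm_zset_same.
  have wb b : b != a -> chart_fun c w 0 b != 0 by move=> /zb /wz.
  have wa : chart_fun c w 0 a = 0.
    have [a' wa' _] := codim1_zero cstd wc wf.
    have [<- //|/wb] := eqVneq a' a.
    by rewrite wa' eqxx.
  have E : act t z = z <-> act t w = w.
    by rewrite (codim1_fix t cstd h zc za zb)
      (codim1_fix t cstd h wc wa wb).
  split=> -[z' z'E tz'].
    exists w => //; apply/E; apply: fix_same_orbit tz'; by rewrite z'E.
  exists z => //; apply/E; apply: fix_same_orbit tz'; by rewrite z'E.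
- by rewrite /= in_itv/= lexx ler01.
- by rewrite /= in_itv/= lexx ler01.
- by exists x; rewrite ?segm0.
Qed.

Lemma characteristic_vector f : exists t, t != 0 /\
  forall x, zset (proj x) = [set f]%SET -> act t x = x.
Proof.
have [s z] := facet_centerP f; have [x xE] := proj_surj M s.
rewrite -xE in z.
have [c cstd xc] := sc_standard x; have [phi [psi phiK psiK] h] := std_phi cstd.
have [a xa xb] := codim1_zero cstd xc z.
exists (psi (delta_mx 0 a)); split.
  apply/eqP => /(congr1 phi); rewrite psiK raddf0 => /rowP /(_ a) /eqP.
  by rewrite !mxE !eqxx oner_eq0.
move=> y yf; apply: codim1_fix_constant z yf _.
apply/(codim1_fix _ cstd h xc xa xb) => b ba.
by rewrite psiK mxE/= (negbTE ba).
Qed.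

(** The characteristic function of Davis and Januszkiewicz. *)
Definition lam f : Z2 N := sval (cid (characteristic_vector f)).

Lemma lam_neq0 f : lam f != 0.
Proof. by rewrite /lam; case: cid => t []. Qed.

Lemma lam_fix f x : zset (proj x) = [set f]%SET -> act (lam f) x = x.
Proof. by rewrite /lam; case: cid => t [_ +] /=; exact. Qed.

Lemma lam_chart c phi x f a : std c -> injective phi -> phi 0 = 0 ->
  (forall t x, chart_dom c x ->
    chart_fun c (act t x) = standard_act (phi t) (chart_fun c x)) ->
  chart_dom c x -> zset (proj x) = [set f]%SET -> chart_fun c x 0 a = 0 ->
  phi (lam f) = delta_mx 0 a.
Proof.
move=> cstd phi_inj phi0 h xc xf xa.
have [a' xa' xb] := codim1_zero cstd xc xf.
have e : a = a' by apply: contra_eq xa => /xb.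
rewrite -{}e in xb.
have := lam_fix xf; rewrite (codim1_fix _ cstd h xc xa xb) => lb.
apply/rowP => b; rewrite !mxE/=; have [->|/lb//] := eqVneq b a.
have [l0|//] := F2_case (phi (lam f) 0 a).
move/negP: (lam_neq0 f); case; apply/eqP/phi_inj; rewrite phi0.
apply/rowP => d; rewrite mxE; have [->|/lb] := eqVneq d a => //.
Qed.

(** The segment from [proj x] to the barycentre of the facet meets no other
    facet, except in [proj x]. *)
Lemma near_facet x f (A : set M) : nbhs x A -> f \in zset (proj x) ->
  exists2 y, A y & zset (proj y) = [set f]%SET.
Proof.
move=> Ax; rewrite inE => /eqP xf.
have [fs fz] := facet_centerP f; have sx := proj_simplex x.
pose q u := segm (proj x) (face_center [set f]%SET) u.
have B := proj_nbhs Ax; rewrite -(segm0 (proj x) (face_center [set f]%SET)) in B.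
have {B} /nbhs_ballP [e /= e0 B] : \forall u \near (0 : R),
    simplex_prod R n (q u) -> exists2 w, A w & proj w = q u.
  by have := @continuous_segm _ _ _ _ _ (0 : R) _ B.
pose u := Num.min 1 (e / 2).
have u0 : 0 < u by rewrite lt_min ltr01 divr_gt0.
have u1 : u <= 1 by rewrite ge_min lexx.
have [||y yA yE] := B u.
- rewrite /ball/= sub0r normrN gtr0_norm//.
  by rewrite gt_min [e / 2 < e]ltr_pdivrMr// ltr_pMr// ltr1n orbT.
- by apply: segm_simplex => //; rewrite ltW.
exists y => //; rewrite yE; apply/setP => g.
move/setP/(_ g): (fz); rewrite !inE bary_segm; have [-> /eqP ->|_ gz] := eqVneq g f.
  by rewrite xf !mulr0 addr0 eqxx.
apply/negbTE; rewrite gt_eqF//; apply: ltr_wpDl.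
  by rewrite mulr_ge0 ?subr_ge0// bary_ge0.
by rewrite mulr_gt0// lt_neqAle eq_sym gz bary_ge0.
Qed.

(** Within one chart, distinct facets correspond to distinct coordinate
    hyperplanes: the open quadrant of a coordinate hyperplane inside a small
    ball is convex, hence lies over a single facet. *)
Lemma chart_facet_inj c (v : 'rV[R]_N) e a y y' f f' : std c ->
  ball v e `<=` chart_cod c ->
  chart_dom c y -> chart_dom c y' ->
  ball v e (vabs (chart_fun c y)) -> ball v e (vabs (chart_fun c y')) ->
  zset (proj y) = [set f]%SET -> zset (proj y') = [set f']%SET ->
  chart_fun c y 0 a = 0 -> chart_fun c y' 0 a = 0 -> f = f'.
Proof.
move=> cstd vc yc yc' yv yv' yf yf' ya ya'.
have [a1 ya1 yb] := codim1_zero cstd yc yf.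
have e1 : a = a1 by apply: contra_eq ya => /yb.
rewrite -{a1 ya1}e1 in yb.
have [a1 ya1 yb'] := codim1_zero cstd yc' yf'.
have e1 : a = a1 by apply: contra_eq ya' => /yb'.
rewrite -{a1 ya1}e1 in yb'.
pose w := vabs (chart_fun c y); pose w' := vabs (chart_fun c y').
pose z (u : R) := (1 - u) *: w + u *: w'.
have zb u : 0 <= u <= 1 -> ball v e (z u).
  move=> /andP[u0 u1]; case: yv yv' => e0 yv [_ yv']; split=> // i j.
  move: (yv i j) (yv' i j); rewrite /ball/= => h h'.
  have -> : v i j - z u i j =
      (1 - u) * (v i j - w i j) + u * (v i j - w' i j).
    by rewrite !mxE; lra.
  have [->|u0'] := eqVneq u 0; first by rewrite subr0 mul1r mul0r addr0.
  rewrite (le_lt_trans (ler_normD _ _))// !normrM.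
  have -> : e = (1 - u) * e + u * e by lra.
  rewrite ler_ltD//.
    by rewrite ger0_norm ?subr_ge0// ler_wpM2l ?subr_ge0// ltW.
  by rewrite ger0_norm// ltr_pM2l// lt_neqAle u0 eq_sym u0'.
have zc u : 0 <= u <= 1 -> chart_cod c (z u) by move=> /zb /vc.
have z1 u : 0 <= u <= 1 -> #|zset (proj (chart_inv c (z u)))| = 1%N.
  move=> u01; have [ic iE] := chart_invP cstd (zc u u01).
  rewrite -(zeros_chart cstd ic) iE zerosE; apply/eqP/cards1P; exists a.
  apply/setP => b; rewrite !inE !mxE; have [->|ba] := eqVneq b a.
    by rewrite ya ya' normr0 !mulr0 addr0 eqxx.
  move/andP: u01 => [u0 u1].
  apply/negbTE; rewrite gt_eqF//.
  have [->|u0'] := eqVneq u 0.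
    by rewrite subr0 mul1r mul0r addr0 normr_gt0 yb.
  apply: ltr_wpDl; first by rewrite mulr_ge0// subr_ge0.
  by rewrite mulr_gt0 ?normr_gt0 ?yb'// lt_neqAle u0 eq_sym u0'.
have z_end (y0 : M) : chart_dom c y0 ->
    proj (chart_inv c (vabs (chart_fun c y0))) = proj y0.
  by move=> yc0; rewrite -(lsecE cstd)// proj_lsec.
pose P u := f \in zset (proj (chart_inv c (z u))).
have : P 1.
  apply: (@connected_locally_constant _ (`[0, 1]%classic : set R) P _ _ 0).
  - exact: segment_connected.
  - move=> u; rewrite /= in_itv/= => u01.
    have cont g : bary (proj (chart_inv c (z v))) g @[v --> u] -->
        bary (proj (chart_inv c (z u))) g.
      apply: (continuous_cvg _ (@continuous_bary _ _ _ g _)).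
      apply: (continuous_cvg _ (@sc_proj_cont _ _ _ M _)).
      apply: (continuous_cvg _ (chart_inv_cvg cstd (zc u u01))).
      apply: cvgD; apply: cvgZl; last exact: cvg_id.
      by apply: cvgB; [exact: cvg_cst|exact: cvg_id].
    have [Pu|nPu] := boolP (f \in zset (proj (chart_inv c (z u)))).
      have /cards1P [f1 f1E] : #|zset (proj (chart_inv c (z u)))| == 1%N.
        by rewrite z1.
      have B : \forall v \near u, forall g, g != f ->
          bary (proj (chart_inv c (z v))) g != 0.
        apply: (@filter_forall _ _ (fun (g : facet) v =>
          g != f -> bary (proj (chart_inv c (z v))) g != 0) (nbhs u) _) => g.
        suff H : g != f -> \forall v \near u, bary (proj (chart_inv c (z v))) g != 0.
          have [gf|/H gf] := eqVneq g f; first by apply: nearW => v'; rewrite gf.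
          by apply: filterS gf.
        move=> gf.
        have g0 : bary (proj (chart_inv c (z u))) g != 0.
          move: Pu gf; rewrite f1E inE => /eqP ->; move/setP/(_ g): f1E.
          by rewrite !inE => ->.
        exact: (@cvgr_neq0 R R _ _ _ _ _ (cont g) g0).
      apply: filterS B => v' Bv; rewrite /= in_itv/= => v01.
      rewrite /P Pu; split=> // _.
      have /cards1P [f2 f2E] : #|zset (proj (chart_inv c (z v')))| == 1%N.
        by rewrite z1.
      have : f2 \in zset (proj (chart_inv c (z v'))) by rewrite f2E inE.
      have [<- //|/Bv] := eqVneq f2 f.
      by rewrite inE => /negbTE ->.
    have f0 : bary (proj (chart_inv c (z u))) f != 0 by move: nPu; rewrite inE.
    have H : \forall v \near u, bary (proj (chart_inv c (z v))) f != 0.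
      exact: (@cvgr_neq0 R R _ _ _ _ _ (cont f) f0).
    apply: filterS H => v' vf _.
    by rewrite /P !inE (negbTE f0) (negbTE vf).
  - by rewrite /= in_itv/= lexx ler01.
  - by rewrite /= in_itv/= lexx ler01.
  - by rewrite /P /z subr0 scale1r scale0r addr0 z_end// yf inE.
by rewrite /P /z subrr scale0r scale1r add0r z_end// yf' inE => /eqP.
Qed.

(** Facets through the point and vanishing coordinates in the chart are equal in
    number because the projection preserves codimension, so that an injection
    between them is a bijection. *)
Lemma chart_facets c phi x : std c -> injective phi -> phi 0 = 0 ->
  (forall t x, chart_dom c x ->
    chart_fun c (act t x) = standard_act (phi t) (chart_fun c x)) ->
  chart_dom c x ->
  exists af : facet -> 'I_N, [/\ {in zset (proj x) &, injective af},
    forall f, f \in zset (proj x) -> phi (lam f) = delta_mx 0 (af f) &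
    forall b, chart_fun c x 0 b = 0 <-> exists2 f, f \in zset (proj x) & b = af f].
Proof.
move=> cstd phi_inj phi0 h xc.
pose v := vabs (chart_fun c x).
have vcod : chart_cod c v by apply: (cod_vabs cstd _).1; exact: chart_codP.
have /nbhs_ballP [e /= e0 vc] : nbhs v (chart_cod c).
  exact: (open_nbhs_nbhs (conj (open_cod cstd) vcod)).
pose A := [set y | (chart_dom c y /\
    forall b, chart_fun c x 0 b != 0 -> chart_fun c y 0 b != 0) /\
    ball v e (vabs (chart_fun c y))].
have Ax : nbhs x A.
  apply: filterI; first exact: near_nonzero.
  have : {for x, continuous (@vabs R N \o chart_fun c)}.
    apply: continuous_comp; first exact: chart_fun_cvg.
    exact: continuous_vabs.
  by apply; exact: nbhsx_ballx.
have ex f : f \in zset (proj x) -> exists a y, [/\ A y,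
    zset (proj y) = [set f]%SET, chart_fun c y 0 a = 0 & chart_fun c x 0 a = 0].
  move=> /(near_facet Ax) [y yA yf].
  have [a ya _] := codim1_zero cstd yA.1.1 yf.
  exists a, y; split => //; apply/eqP; apply: contraPT ya => /yA.1.2 /eqP.
  by [].
have ex' f : exists a, f \in zset (proj x) -> exists y, [/\ A y,
    zset (proj y) = [set f]%SET, chart_fun c y 0 a = 0 & chart_fun c x 0 a = 0].
  have [/ex [a ?]|_] := boolP (f \in zset (proj x)); first by exists a.
  by exists (tagnat.rank (existT (fun k => 'I_(n k)) (tag f)
    (Ordinal (n_gt0 (tag f))))).
pose af f := sval (cid (ex' f)).
have afP f : f \in zset (proj x) -> exists y, [/\ A y,
    zset (proj y) = [set f]%SET, chart_fun c y 0 (af f) = 0 &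
    chart_fun c x 0 (af f) = 0] by rewrite /af; case: cid.
have af_inj : {in zset (proj x) &, injective af}.
  move=> f f' /afP [y [yA yf ya _]] /afP [y' [yA' yf' ya' _]] ff'.
  apply: (chart_facet_inj (a := af f) cstd vc yA.1.1 yA'.1.1 yA.2 yA'.2 yf yf') => //.
  by rewrite ff'.
have img : [set af f | f in zset (proj x)]%SET =
    [set b | chart_fun c x 0 b == 0]%SET.
  apply/eqP; rewrite eqEcard card_in_imset//; apply/andP; split.
    apply/fintype.subsetP => _ /imsetP [f /afP [y [_ _ _ xa]] ->].
    by rewrite inE xa.
  by rewrite -(zeros_chart cstd xc) zerosE.
exists af; split => // [f /afP [y [yA yf ya _]]|b].
  exact: (lam_chart cstd phi_inj phi0 h yA.1.1 yf ya).
have bE := img; move/setP/(_ b): bE; rewrite inE => bE.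
split=> [/eqP|[f fx ->]]; first by rewrite -bE => /imsetP.
by have [y []] := afP f fx.
Qed.

(** In a chart the isotropy group is the span of the basis vectors of the
    vanishing coordinates, which are the vectors of the facets. *)
Lemma fix_comb x t : act t x = x <->
  exists2 w, forall f, w f = 0 \/ bary (proj x) f = 0 & t = comb lam w.
Proof.
have [c cstd xc] := sc_standard x; have [phi [psi phiK psiK] h] := std_phi cstd.
have phi_inj := can_inj phiK.
have [af [af_inj afE af0]] := chart_facets cstd phi_inj (raddf0 phi) h xc.
have combE w b : (forall f, w f = 0 \/ bary (proj x) f = 0) ->
    phi (comb lam w) 0 b =
    \sum_(f in zset (proj x)) w f * (b == af f)%:R.
  move=> wz; rewrite comb_raddf /comb summxE (bigID (mem (zset (proj x))))/=.
  rewrite [X in _ + X]big1 ?addr0; last first.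
    move=> f; rewrite inE => /negP fx.
    by have [->|/eqP//] := wz f; rewrite scale0r mxE.
  by apply: eq_bigr => f fx; rewrite afE// !mxE/=.
rewrite (chart_fix t cstd h xc); split=> [ht|[w wz ->] b].
  exists (fun f => if f \in zset (proj x) then phi t 0 (af f) else 0).
    move=> f; case: ifP => [|_]; last by left.
    by rewrite inE => /eqP; right.
  apply: phi_inj; apply/rowP => b; rewrite combE; last first.
    move=> f; case: ifP => [|_]; last by left.
    by rewrite inE => /eqP; right.
  have [/af0 [f fx ->]|b0] := eqVneq (chart_fun c x 0 b) 0.
    rewrite (bigD1 f)//= fx eqxx mulr1 [X in _ + X]big1 ?addr0// => g /andP[gx gf].
    case: eqP => [/esym /(af_inj _ _ gx fx) e|_]; last by rewrite mulr0.
    by rewrite e eqxx in gf.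
  have [->|e] := ht b; last by rewrite e eqxx in b0.
  rewrite big1// => f fx; case: eqP => [e|_]; last by rewrite mulr0.
  by move: b0; rewrite (af0 b).2 ?eqxx//; exists f.
have [/eqP b0|b0] := eqVneq (chart_fun c x 0 b) 0; first by right; apply/eqP.
left; rewrite combE// big1// => f fx; case: eqP => [e|_]; last by rewrite mulr0.
by move: b0; rewrite (af0 b).2 ?eqxx//; exists f.
Qed.

(** Facets with a common point have independent vectors, because a chart at that
    point sends them to distinct basis vectors. *)
Lemma lam_nonsingular : nonsingular lam.
Proof.
move=> w w0 wz f; pose S := [set g | w g != 0]%SET.
have [cs cz] : simplex_prod R n (face_center S) /\
    zset (face_center S : X) = S.
  apply: face_centerP => i; have [j wj] := wz i; exists j.
  by rewrite inE wj eqxx.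
have [x xE] := proj_surj M cs.
have [c cstd xc] := sc_standard x; have [phi [psi phiK psiK] h] := std_phi cstd.
have phi_inj := can_inj phiK.
have [af [af_inj afE af0]] := chart_facets cstd phi_inj (raddf0 phi) h xc.
rewrite xE cz in af_inj afE af0.
have [//|wf] := eqVneq (w f) 0.
have fS : f \in S by rewrite inE.
move: (congr1 (fun t => phi t 0 (af f)) w0).
rewrite raddf0 mxE comb_raddf /comb summxE (bigD1 f)//= [X in _ + X]big1 ?addr0.
  by rewrite afE// !mxE !eqxx mulr1.
move=> g gf; have [->|wg] := eqVneq (w g) 0; first by rewrite scale0r mxE.
have gS : g \in S by rewrite inE.
rewrite afE// !mxE/=; case: eqP => [/esym /(af_inj _ _ gS fS) e|_].
  by rewrite e eqxx in gf.
by rewrite mulr0.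
Qed.

End Isotropy.

Section NormalForm.
Local Open Scope ring_scope.
Context {R : realType} {l : nat} {n : 'I_l -> nat}.
Local Notation N := (\sum_(i < l) n i)%N.

(** [M] has the isotropy groups prescribed by [A], up to an automorphism. *)
Definition has_form (M : small_cover R n) (A : 'M['F_2]_(l, N)) : Prop :=
  exists2 phi : {additive Z2 N -> Z2 N}, bijective phi &
    forall (x : M) t, sc_act t x = x <->
      exists2 w, forall f, w f = 0 \/ bary (sc_proj x) f = 0 &
        phi t = comb (lamA A) w.

Lemma has_form_exists (M : small_cover R n) : (forall i, (0 < n i)%N) ->
  exists2 A, good A & has_form M A.
Proof.
move=> n0; have [A [phi [gA phib phiE]]] := normal_form (@lam_nonsingular _ _ _ M n0).
exists A => //; exists phi => // x t; rewrite (fix_comb n0).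
have E w : phi (comb (lam M n0) w) = comb (lamA A) w.
  by rewrite comb_raddf; apply: eq_bigr => f _ /=; rewrite phiE.
split=> -[w wz]; first by move=> ->; exists w.
rewrite -E => /(bij_inj phib) ->; by exists w.
Qed.

Lemma DJ_equiv_of_form (M1 M2 : small_cover R n) A :
  has_form M1 A -> has_form M2 A -> DJ_equiv M1 M2.
Proof.
move=> [phi1 phi1b h1] [phi2 phi2b h2].
have [psi [phi2K psi2K]] := additive_inverse phi2b.
have psib : bijective psi by exists phi2.
apply: (@DJ_equiv_of_isotropy _ _ _ _ _ (psi \o phi1)).
  exact: bij_comp.
by move=> x y t xy; rewrite h1 h2 /= psi2K xy.
Qed.

Lemma has_form_DJ (M1 M2 : small_cover R n) A :
  DJ_equiv M1 M2 -> has_form M1 A -> has_form M2 A.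
Proof.
move=> /DJ_equiv_sym [phi [f [g [phib [_ _ fK gK] fE fp]]]] [phi1 phi1b h1].
exists (phi1 \o phi); first exact: bij_comp.
move=> x t /=; rewrite -fp -h1 -fE; split=> [->//|/(can_inj fK)//].
Qed.

(** The isotropy groups over the barycentres of the facets determine all vectors
    up to one automorphism, and the standard basis fixes this automorphism. *)
Lemma has_form_inj (M : small_cover R n) A B : (forall i, (0 < n i)%N) ->
  good A -> good B -> has_form M A -> has_form M B -> A = B.
Proof.
move=> n0 gA gB [phi phib hA] [phi' phib' hB].
have [psi [phiK psiK]] := additive_inverse phib.
have nz f : lamA A f != 0.
  apply/eqP => f0; have [ns _] := good_nonsingular A.
  have := ns gA (fun g => (g == f)%:R) _ _ f; rewrite eqxx => h.
  suff /eqP : (1 : 'F_2) = 0 by rewrite oner_eq0.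
  apply: h.
    rewrite /comb (bigD1 f)//= eqxx scale1r f0 add0r [LHS]big1// => g /negbTE ->.
    by rewrite scale0r.
  move=> i; have [j /negbTE jf] := facet_avoid f (n0 i).
  by exists j; rewrite jf.
have key f : phi' (psi (lamA A f)) = lamA B f.
  have [s z] := facet_centerP (R := R) n0 f.
  have [x xE] := proj_surj M s.
  have fx g : bary (sc_proj x) g = 0 -> g = f.
    by move/eqP => g0; apply/eqP; move/setP/(_ g): z; rewrite -xE !inE g0.
  have xf : bary (sc_proj x) f = 0.
    by apply/eqP; move/setP/(_ f): z; rewrite -xE !inE eqxx.
  have single (C : 'M['F_2]_(l, N)) w :
      (forall g, w g = 0 \/ bary (sc_proj x) g = 0) ->
      comb (lamA C) w = w f *: lamA C f.
    move=> wz; rewrite /comb (bigD1 f)//= [X in _ + X]big1 ?addr0// => g gf.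
    have [->|/fx e] := wz g; first by rewrite scale0r.
    by rewrite e eqxx in gf.
  have [w wz] : exists2 w, forall g, w g = 0 \/ bary (sc_proj x) g = 0 &
      phi' (psi (lamA A f)) = comb (lamA B) w.
    apply/hB/hA; rewrite psiK; exists (fun g => (g == f)%:R).
      by move=> g; case: eqP => [->|_]; [right|left].
    by rewrite single ?eqxx ?scale1r// => g; case: eqP => [->|_]; [right|left].
  rewrite single//; have [->|->] := F2_case (w f); last by rewrite scale1r.
  rewrite scale0r -(raddf0 phi') => /(bij_inj phib') /(congr1 phi).
  by rewrite psiK raddf0 => /eqP; rewrite (negbTE (nz f)).
have chi t : phi' (psi t) = t.
  rewrite -[in LHS](comb_del A t) !comb_raddf -[RHS](comb_del B t).
  by apply: eq_bigr => f _ /=; rewrite key.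
apply/row_matrixP => i.
by rewrite -!lamA_ord0 -key chi.
Qed.

End NormalForm.

(** * Smoothness of rational maps *)

Section RationalMaps.
Local Open Scope classical_set_scope.
Local Open Scope ring_scope.
Context {R : realType} {m : nat}.
Local Notation E := 'rV[R]_m.
Implicit Types (A B : set E) (f g : E -> R) (F G : E -> E) (v x : E).

(** Rational functions of the coordinates without poles on [A]. *)
Inductive rational (A : set E) : (E -> R) -> Prop :=
| rational_cst a : rational A (cst a)
| rational_coord j : rational A (fun y => y 0 j)
| rational_add f g : rational A f -> rational A g -> rational A (f + g)
| rational_mul f g : rational A f -> rational A g -> rational A (f * g)
| rational_inv f : rational A f -> (forall x, A x -> f x != 0) ->
    rational A (fun y => (f y)^-1).

Lemma derive_coord j v x :
  derivable (fun y : E => y 0 j) x v /\ 'D_v (fun y : E => y 0 j) x = v 0 j.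
Proof.
have did := @derivable_id R E x v.
have /(derivable_mxP (fun y : E => y)) dc := did.
split; first exact: dc.
have := derive_mx did; rewrite derive_id => /matrixP /(_ 0 j).
by rewrite mxE => <-.
Qed.

(** This closure property reduces iterated derivatives to first ones. *)
Lemma rational_derive A f v : rational A f ->
  (forall x, A x -> derivable f x v) /\
  exists2 g, rational A g & forall x, A x -> 'D_v f x = g x.
Proof.
elim=> [a|j|{}f g _ [df [f' rf' f'E]] _ [dg [g' rg' g'E]]||].
- split=> [x _|]; first exact: derivable_cst.
  by exists (cst 0) => [|x _]; [exact: rational_cst|rewrite derive_cst].
- split=> [x _|]; first by case: (derive_coord j v x).
  exists (cst (v 0 j)) => [|x _]; first exact: rational_cst.
  by case: (derive_coord j v x).
- split=> [x Ax|]; first by apply: derivableD; [exact: df|exact: dg].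
  exists (f' + g') => [|x Ax]; first exact: rational_add.
  by rewrite deriveD ?f'E ?g'E//; [exact: df|exact: dg].
- move=> {}f g rf [df [f' rf' f'E]] rg [dg [g' rg' g'E]].
  split=> [x Ax|]; first by apply: derivableM; [exact: df|exact: dg].
  exists (f * g' + g * f') => [|x Ax].
    by apply: rational_add; apply: rational_mul.
  by rewrite deriveM ?f'E ?g'E//; [exact: df|exact: dg].
- move=> {}f rf [df [f' rf' f'E]] f0.
  split=> [x Ax|]; first by apply: derivableV; [exact: f0|exact: df].
  exists (cst (-1) * ((fun y => (f y)^-1) * (fun y => (f y)^-1)) * f').
    apply: rational_mul => //; apply: rational_mul; first exact: rational_cst.
    by apply: rational_mul; apply: rational_inv.
  move=> x Ax; rewrite deriveV ?f'E//; [|exact: f0|exact: df].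
  by rewrite /GRing.scale /= !fctE mulN1r expr2 invfM.
Qed.

Lemma rational_continuous A f x : rational A f -> A x -> {for x, continuous f}.
Proof.
move=> rf Ax; elim: rf => [a|j|{}f g _ cf _ cg|{}f g _ cf _ cg|{}f _ cf f0].
- exact: (@cst_continuous _ _ a x).
- exact: (@coord_continuous _ _ _ 0 j x).
- exact: (cvgD cf cg).
- exact: (cvgM cf cg).
- exact: (cvgV (f0 x Ax) cf).
Qed.

Lemma near_open A x (P : E -> Prop) : open A -> A x ->
  (forall y, A y -> P y) -> \forall y \near x, P y.
Proof. by move=> oA Ax AP; apply: filterS (open_nbhs_nbhs (conj oA Ax)). Qed.

(** The components of every iterated derivative are again rational. *)
Lemma smooth_on_rational A F : open A ->
  (forall j, rational A (fun y => F y 0 j)) -> smooth_on A F.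
Proof.
move=> oA rF.
have iterE vs : exists2 G : E -> E, forall j, rational A (fun y => G y 0 j) &
    forall x, A x -> iter_derive vs F x = G x.
  elim: vs => [|v vs [G rG GE]]; first by exists F.
  have dG x : A x -> derivable G x v.
    move=> Ax; apply/derivable_mxP => i j; rewrite (ord1 i).
    by have [+ _] := rational_derive v (rG j); exact.
  have ex j : exists g, rational A g /\
      forall x, A x -> 'D_v (fun y => G y 0 j) x = g x.
    by have [_ [g rg gE]] := rational_derive v (rG j); exists g.
  pose g j := sval (cid (ex j)).
  have gP j : rational A (g j) /\
      forall x, A x -> 'D_v (fun y => G y 0 j) x = g j x.
    by rewrite /g; case: cid.
  exists (fun y => \row_j g j y) => [j|x Ax].
    rewrite (_ : (fun y => _) = g j); first by case: (gP j).
    by apply/funext => y; rewrite mxE.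
  rewrite /= (near_eq_derive (g := G)); last exact: (near_open oA Ax).
  rewrite derive_mx; last exact: dG.
  by apply/rowP => j; rewrite !mxE; have [_ ->] := gP j.
move=> vs x Ax; have [G rG GE] := iterE vs.
have near_eq : \forall y \near x, G y = iter_derive vs F y.
  by apply: (near_open oA Ax) => y Ay; rewrite GE.
split=> [|v].
  have cG : {for x, continuous G}.
    apply: (cvg_rowP (F := nbhs x)) => j; exact: (rational_continuous (rG j)).
  change (iter_derive vs F y @[y --> x] --> iter_derive vs F x).
  rewrite -(nbhs_singleton near_eq).
  exact: cvg_trans (near_eq_cvg near_eq) cG.
apply: (near_eq_derivable near_eq).
apply/derivable_mxP => i j; rewrite (ord1 i).
by have [+ _] := rational_derive v (rG j); exact.
Qed.

Lemma smooth_on_local A F :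
  (forall x, A x -> exists B G, [/\ open B, B x, smooth_on B G &
    forall y, B y -> F y = G y]) -> smooth_on A F.
Proof.
move=> loc vs x Ax; have [B [G [oB Bx sG FG]]] := loc x Ax.
have iterE ws y : B y -> iter_derive ws F y = iter_derive ws G y.
  elim: ws y => [|w ws IH] y By; first exact: FG.
  by rewrite /=; apply: near_eq_derive; exact: (near_open oB By).
have near_eq : \forall y \near x, iter_derive vs G y = iter_derive vs F y.
  by apply: (near_open oB Bx) => y By; rewrite iterE.
have [cG dG] := sG vs x Bx; split=> [|v].
  change (iter_derive vs F y @[y --> x] --> iter_derive vs F x).
  rewrite -(nbhs_singleton near_eq).
  exact: cvg_trans (near_eq_cvg near_eq) cG.
exact: (near_eq_derivable near_eq).
Qed.

End RationalMaps.

(** * Quotients of a product of spheres *)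

Section SignChanges.
Local Open Scope classical_set_scope.
Local Open Scope ring_scope.
Context {R : realType} {l : nat} {n : 'I_l -> nat}.
Local Notation X := (simplex_prod_space R n).
Local Notation facet := {i : 'I_l & 'I_(n i).+1}.
Local Notation fct i j := (existT (fun k : 'I_l => 'I_(n k).+1) i j).
Implicit Types (w : facet -> 'F_2) (x y : X) (f : facet).

Definition sflip w x : X := fun i => \row_j (sgn (w (fct i j)) * x i 0 j).

Lemma bary_sflip w x f : bary (sflip w x) f = sgn (w f) * bary x f.
Proof. by case: f => i j; rewrite /bary /sflip mxE. Qed.

Lemma sflipD w w' x : sflip (fun f => w f + w' f) x = sflip w (sflip w' x).
Proof. by apply: bary_ext => f; rewrite !bary_sflip sgnD mulrA. Qed.

Lemma sflip0 w x : (forall f, w f = 0) -> sflip w x = x.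
Proof. by move=> w0; apply: bary_ext => f; rewrite bary_sflip w0 sgn0 mul1r. Qed.

Lemma sflip_ext w w' x : w =1 w' -> sflip w x = sflip w' x.
Proof. by move=> e; apply: bary_ext => f; rewrite !bary_sflip e. Qed.

Lemma sflip_fix w x :
  sflip w x = x <-> forall f, w f = 0 \/ bary x f = 0.
Proof.
split=> [e f|h]; first by apply/(@sgn_fix R); rewrite -bary_sflip e.
by apply: bary_ext => f; rewrite bary_sflip; exact/sgn_fix.
Qed.

Lemma continuous_sflip w : continuous (sflip w).
Proof.
move=> x; apply: (cvg_bary (F := nbhs x)) => f.
under eq_fun do rewrite bary_sflip.
rewrite bary_sflip; apply: cvgM; first exact: cvg_cst.
exact: continuous_bary.
Qed.

Definition square x : X := fun i => \row_j (x i 0 j) ^+ 2.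

Lemma bary_square x f : bary (square x) f = bary x f ^+ 2.
Proof. by case: f => i j; rewrite /bary mxE. Qed.

Lemma continuous_square : continuous square.
Proof.
move=> x; apply: (cvg_bary (F := nbhs x)) => f.
under eq_fun do rewrite bary_square expr2.
by rewrite bary_square expr2; apply: cvgM; exact: continuous_bary.
Qed.

Lemma square_sflip w x : square (sflip w x) = square x.
Proof.
apply: bary_ext => f.
by rewrite !bary_square bary_sflip exprMn expr2 sgn_sqr mul1r.
Qed.

Lemma zset_square x : zset (square x) = zset x.
Proof. by apply/setP => f; rewrite !inE bary_square sqrf_eq0. Qed.

Lemma square_eq x y : square x = square y -> exists w, y = sflip w x.
Proof.
move=> e; exists (fun f => sbit (bary x f) + sbit (bary y f)).
have xy f : `|bary x f| = `|bary y f|.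
  move: (congr1 (bary^~ f) e); rewrite !bary_square => /eqP.
  by rewrite eqf_sqr => /orP[] /eqP ->; rewrite ?normrN.
apply: bary_ext => f; rewrite bary_sflip addrC sgnD -mulrA sgn_sbit xy.
by rewrite -sgn_sbit mulrA sgn_sqr mul1r.
Qed.

(** The product of the unit spheres, on which the group of all sign changes
    acts with quotient the product of simplices. *)
Definition spheres : set X := [set x | forall i, \sum_j (x i 0 j) ^+ 2 = 1].

Lemma spheres_square x : spheres x <-> simplex_prod R n (square x).
Proof.
have E i : \sum_j square x i 0 j = \sum_j (x i 0 j) ^+ 2.
  by apply: eq_bigr => j _; rewrite mxE.
split=> h i; last by rewrite -E; have [] := h i.
by split=> [j|]; rewrite ?mxE ?sqr_ge0// E.
Qed.

Lemma compact_spheres : compact spheres.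
Proof.
have cS i : compact [set v : 'rV[R]_(n i).+1 | \sum_j (v 0 j) ^+ 2 = 1].
  apply: (@subclosed_compact _ _
      [set v : 'rV[R]_(n i).+1 | forall j, v ord0 j \in `[(-1 : R), 1]]).
  - apply: (@closed_equalizer _ R
      (fun v : 'rV[R]_(n i).+1 => \sum_j (v 0 j) ^+ 2) (fun=> 1)).
    - exact: (@norm_hausdorff R R).
    - move=> v; apply: (@cvg_sumr _ _ _ (nbhs v)) => j.
      under eq_fun do rewrite expr2.
      by rewrite expr2; apply: cvgM; exact: coord_continuous.
    - move=> v; exact: (@cst_continuous _ _ (1 : R) v).
  - apply: (@rV_compact R _ (fun _ => `[(-1 : R), 1]%classic)) => j.
    exact: segment_compact.
  - move=> v /= v1 j; rewrite in_itv/= -ler_norml.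
    have : (v 0 j) ^+ 2 <= 1.
      by rewrite -v1 (bigD1 j)//= lerDl sumr_ge0// => k _; exact: sqr_ge0.
    by rewrite -(real_normK (num_real _)) expr_le1.
exact: (tychonoff cS).
Qed.

End SignChanges.

Section Model.
Local Open Scope classical_set_scope.
Local Open Scope ring_scope.
Local Open Scope quotient_scope.
Context {R : realType} {l : nat} {n : 'I_l -> nat}.
Local Notation N := (\sum_(i < l) n i)%N.
Local Notation X := (simplex_prod_space R n).
Local Notation facet := {i : 'I_l & 'I_(n i).+1}.
Local Notation fct i j := (existT (fun k : 'I_l => 'I_(n k).+1) i j).
Local Notation cell i j := (@tagnat.rank l n (existT (fun k : 'I_l => 'I_(n k)) i j)).
Variable A : 'M['F_2]_(l, N).

Local Notation S := (set_type (spheres : set X)).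
Local Notation val := (@set_val X spheres).

Lemma sphereP (s : S) : spheres (val s). Proof. exact: set_valP. Qed.

Lemma sphere_inj : injective val. Proof. exact: val_inj. Qed.

Lemma cvg_sphere (T : Type) (F : set_system T) (FF : Filter F) (g : T -> S) (s : S) :
  val (g t) @[t --> F] --> val s -> g t @[t --> F] --> s.
Proof.
move=> h B [_ [[U oU <-] Us] sB].
by apply: (filterS sB); apply: h; exact: open_nbhs_nbhs.
Qed.

Lemma continuous_sphere_val : continuous val.
Proof. exact: initial_continuous. Qed.

Lemma hausdorff_spheres : hausdorff_space S.
Proof.
rewrite open_hausdorff => s s' ss'.
have ne : val s != val s' by apply: contraNneq ss' => /sphere_inj ->.
move: (@hausdorff_simplex_prod_space R l n); rewrite open_hausdorff => /(_ _ _ ne) [[B C] /=].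
move=> [/set_mem Bs /set_mem Cs] [oB oC /eqP BC].
exists (val @^-1` B, val @^-1` C); first by split; apply: mem_set.
split => /=; [by exists B|by exists C|].
by apply/eqP; rewrite -preimage_setI BC preimage_set0.
Qed.

Lemma compact_sphere_type : compact [set: S].
Proof.
move=> F FF _.
have FX : ProperFilter (val @ F) by exact: fmap_proper_filter.
have vF : F (val @^-1` spheres) by apply: filterE => s; exact: sphereP.
have [x [xZ xF]] := @compact_spheres R l n (val @ F) FX vF.
pose s0 : S := exist (fun x => x \in spheres) x (mem_set xZ).
exists s0; split => // B C FB [_ [[U oU <-] Ux] sC].
have : (val @ F) (val @` B).
  by apply: (@filterS _ F _ B) => // s Bs; exists s.
move=> /xF /(_ (open_nbhs_nbhs (conj oU Ux))) [_ [[s Bs <-] Os]].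
by exists s; split => //; exact: sC.
Qed.

Lemma sflip_spheres w (s : S) : spheres (sflip w (val s)).
Proof.
apply/spheres_square; rewrite square_sflip; apply/spheres_square.
exact: sphereP.
Qed.

Definition sact w (s : S) : S := 
  exist (fun x => x \in spheres) _ (mem_set (sflip_spheres w s)).

Lemma val_sact w s : val (sact w s) = sflip w (val s). Proof. by []. Qed.

Lemma continuous_sact w : continuous (sact w).
Proof.
move=> s; apply: (@cvg_sphere _ (nbhs s)).
exact: (continuous_cvg _ (@continuous_sflip _ _ _ w (val s))
  (@continuous_sphere_val s)).
Qed.

Lemma sactD w w' s : sact (fun f => w f + w' f) s = sact w (sact w' s).
Proof. by apply: sphere_inj; rewrite !val_sact sflipD. Qed.

Lemma sactC w w' s : sact w (sact w' s) = sact w' (sact w s).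
Proof.
by rewrite -!sactD; apply: sphere_inj; apply: sflip_ext => f; rewrite addrC.
Qed.

Lemma sactK w s : sact w (sact w s) = s.
Proof.
rewrite -sactD; apply: sphere_inj; rewrite val_sact sflip0// => f.
exact: F2_addxx.
Qed.

Lemma sact_ext w w' s : w =1 w' -> sact w s = sact w' s.
Proof. by move=> e; apply: sphere_inj; exact: sflip_ext. Qed.

Lemma kactD u v s : sact (eps A u) (sact (eps A v) s) = sact (eps A (u + v)) s.
Proof. by rewrite -sactD; apply: sact_ext => f; rewrite epsD. Qed.

(** The sign changes that are relations between the characteristic vectors; the
    quotient of the product of spheres by them is the small cover. *)
Definition same_orbit : rel S := fun s s' => `[< exists u, s' = sact (eps A u) s >].

Lemma same_orbit_refl : reflexive same_orbit.
Proof.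
move=> s; apply/asboolP; exists 0; apply: sphere_inj.
by rewrite val_sact sflip0// => f; exact: eps0.
Qed.

Lemma same_orbit_sym : symmetric same_orbit.
Proof.
suff h s s' : same_orbit s s' -> same_orbit s' s.
  by move=> s s'; apply/idP/idP; exact: h.
by move=> /asboolP [u ->]; apply/asboolP; exists u; rewrite sactK.
Qed.

Lemma same_orbit_trans : transitive same_orbit.
Proof.
move=> s s' s'' /asboolP [u ->] /asboolP [v ->]; apply/asboolP; exists (v + u).
by rewrite kactD.
Qed.

Definition orbit_rel := EquivRel same_orbit same_orbit_refl same_orbit_sym
  same_orbit_trans.

Local Notation M := (quotient_topology {eq_quot orbit_rel}).
Definition model_pi (s : S) : M := \pi s.
Local Notation q := model_pi.

Lemma model_pi_eq s s' : q s = q s' <-> exists u, s' = sact (eps A u) s.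
Proof.
split=> [/eqmodP /asboolP//|h]; apply/eqmodP; exact/asboolP.
Qed.

Lemma model_pi_repr (m : M) : q (repr m) = m. Proof. exact: reprK. Qed.

Lemma model_pi_surj (m : M) : exists s, m = q s.
Proof. by exists (repr m); rewrite model_pi_repr. Qed.

Lemma continuous_model_pi : continuous q. Proof. exact: pi_continuous. Qed.

(** The quotient map is open, as the saturation of an open set is a union of its
    translates. *)
Lemma model_pi_nbhs s (B : set S) : nbhs s B -> nbhs (q s) (q @` B).
Proof.
rewrite nbhsE => -[C [oC Cs] sCB].
apply: (@filterS _ _ _ (q @` C)); first exact: image_subset.
apply: open_nbhs_nbhs; split; last by exists s.
have -> : q @` C = [set m | exists u, (sact (eps A u) @^-1` C) (repr m)].
  rewrite eqEsubset; split=> [_ [s' Cs' <-]|m [u Cm]] /=.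
    have /model_pi_eq [u uE] : q (repr (q s')) = q s' by rewrite model_pi_repr.
    by exists u; rewrite /preimage /= -uE.
  exists (sact (eps A u) (repr m)) => //.
  by rewrite -[RHS]model_pi_repr; apply/esym/model_pi_eq; exists u.
rewrite /open/= /quotient_open.
rewrite (_ : _ @^-1` _ = \bigcup_u (sact (eps A u) @^-1` C)).
  apply: bigcup_open => u _.
  by move/continuousP: (@continuous_sact (eps A u)); apply.
rewrite eqEsubset; split=> s' /= [u].
  move=> Cu; have /model_pi_eq [v vE] : q s' = q (repr (q s')) by rewrite model_pi_repr.
  by exists (u + v) => //; move: Cu; rewrite /preimage /= vE kactD.
move=> _ Cu; have /model_pi_eq [v vE] : q (repr (q s')) = q s' by rewrite model_pi_repr.
by exists (u + v); move: Cu; rewrite /preimage /= {1}vE kactD.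
Qed.

(** Here [g] need only be invariant near [s]: the charts below are not invariant
    outside their domains. *)
Lemma descend_cvg (T : topologicalType) (g : S -> T) s (D : set S) :
  (forall s', D s' -> g (repr (q s')) = g s') -> nbhs s D ->
  {for s, continuous g} -> 
  {for q s, continuous (fun m : M => g (repr m))}.
Proof.
move=> gq Ds gs O; have sD := nbhs_singleton Ds.
rewrite /= gq// => On.
have gO : nbhs s (g @^-1` O) by exact: gs.
apply: filterS (model_pi_nbhs (filterI gO Ds)) => _ [s' [Os' Ds'] <-].
by rewrite /preimage /= gq.
Qed.

(** The group is finite, so one point can be separated from all translates of
    another at the same time. *)
Lemma model_hausdorff : hausdorff_space M.
Proof.
rewrite open_hausdorff => m m' mm'.
have ne u : sact (eps A u) (repr m) <> repr m'.
  move=> e; move/eqP: mm'; apply; rewrite -(model_pi_repr m) -(model_pi_repr m').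
  by apply/model_pi_eq; exists u.
have sep u : exists BC : set S * set S, [/\ nbhs (repr m) (sact (eps A u) @^-1` BC.1),
    nbhs (repr m') BC.2 & BC.1 `&` BC.2 = set0].
  move: hausdorff_spheres; rewrite open_hausdorff => /(_ _ _ (introN eqP (ne u))).
  move=> [[B C] /= [/set_mem Bs /set_mem Cs] [oB oC /eqP BC]].
  exists (B, C); split => //=; last exact: open_nbhs_nbhs.
  by apply: continuous_sact; exact: open_nbhs_nbhs.
pose BC u := sval (cid (sep u)).
have BCP u : [/\ nbhs (repr m) (sact (eps A u) @^-1` (BC u).1),
    nbhs (repr m') (BC u).2 & (BC u).1 `&` (BC u).2 = set0].
  by rewrite /BC; case: cid.
pose B := [set s | forall u, (sact (eps A u) @^-1` (BC u).1) s].
pose C := [set s | forall u, (BC u).2 s].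
have Bm : nbhs (repr m) B.
  apply: (@filter_forall _ _ (fun u => sact (eps A u) @^-1` (BC u).1)
    (nbhs (repr m)) _) => u.
  by have [] := BCP u.
have Cm : nbhs (repr m') C.
  apply: (@filter_forall _ _ (fun u => (BC u).2) (nbhs (repr m')) _) => u.
  by have [] := BCP u.
exists ((q @` B)°, (q @` C)°)%classic.
  split; apply: mem_set; first by have := model_pi_nbhs Bm; rewrite model_pi_repr.
  by have := model_pi_nbhs Cm; rewrite model_pi_repr.
split=> /=; [exact: open_interior|exact: open_interior|].
apply/eqP; rewrite -subset0 => m0 [/interior_subset [s Bs sm]].
move=> /interior_subset [s' Cs' s'm].
have /model_pi_eq [u uE] : q s = q s' by rewrite sm s'm.
have [_ _ e] := BCP u.
suff : ((BC u).1 `&` (BC u).2) s' by rewrite e.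
split; last exact: Cs'.
by rewrite uE; exact: Bs.
Qed.

End Model.

(** * Affine charts *)

Section AffineCharts.
Local Open Scope classical_set_scope.
Local Open Scope ring_scope.
Context {R : realType} {l : nat} {n : 'I_l -> nat}.
Local Notation N := (\sum_(i < l) n i)%N.
Local Notation E := 'rV[R]_N.
Local Notation X := (simplex_prod_space R n).
Local Notation facet := {i : 'I_l & 'I_(n i).+1}.
Local Notation fct i j := (existT (fun k : 'I_l => 'I_(n k).+1) i j).
Local Notation cell i j := (@tagnat.rank l n (existT (fun k : 'I_l => 'I_(n k)) i j)).
Variable A : 'M['F_2]_(l, N).
Hypothesis gA : good A.
Local Notation vert := (forall i : 'I_l, 'I_(n i).+1).
Implicit Types (v w : vert) (x : X) (y : E).

Definition vrow v (u : 'rV['F_2]_l) : 'rV['F_2]_l :=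
  \row_i eps A u (fct i (v i)).

Lemma vrowD v u u' : vrow v (u + u') = vrow v u + vrow v u'.
Proof. by apply/rowP => i; rewrite !mxE epsD. Qed.

(** A relation that vanishes at one facet of each factor is [1] on no whole
    factor, so it is zero; as the group is finite, each choice of signs of the
    coordinates indexed by a vertex is realized by exactly one relation. *)
Lemma vrow_inj v : injective (vrow v).
Proof.
move=> u u' uu'; apply/eqP; rewrite -subr_eq0 -[- u']Z2_opp opprK.
apply: contraT => /gA [i hi].
have : vrow v (u + u') 0 i = 0 by rewrite vrowD uu' Z2_addxx mxE.
by rewrite mxE hi => /eqP; rewrite oner_eq0.
Qed.

Definition theta v : 'rV['F_2]_l -> 'rV['F_2]_l := invF (@vrow_inj v).

Lemma thetaK v s : vrow v (theta v s) = s. Proof. exact: f_invF. Qed.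

Lemma theta_shift v u s : theta v (vrow v u + s) = u + theta v s.
Proof. by apply: (@vrow_inj v); rewrite thetaK vrowD thetaK. Qed.

Lemma theta0 v : theta v 0 = 0.
Proof.
apply: (@vrow_inj v); rewrite thetaK.
by apply/rowP => i; rewrite !mxE eps0.
Qed.

Definition sbits v x : 'rV['F_2]_l := \row_i sbit (bary x (fct i (v i))).

(** The relation whose sign change makes the coordinates indexed by [v]
    positive. *)
Definition corr v x := theta v (sbits v x).
Definition positive v x : X := sflip (eps A (corr v x)) x.

(** The facets through the vertex given by [v] are indexed by the coordinates of
    the chart; [vfacet v a] is the facet opposite to this vertex in the factor of
    [afacet v a]. *)
Definition afacet v (a : 'I_N) : facet :=
  let b := tagnat.sig a in fct (tag b) (lift (v (tag b)) (tagged b)).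
Definition vfacet v (a : 'I_N) : facet :=
  fct (tag (tagnat.sig a)) (v (tag (tagnat.sig a))).

Lemma afacetE v k j : afacet v (cell k j) = fct k (lift (v k) j).
Proof. by rewrite /afacet tagnat.rankK. Qed.

Lemma vfacetE v k j : vfacet v (cell k j) = fct k (v k).
Proof. by rewrite /vfacet tagnat.rankK. Qed.

(** Affine coordinates, as for projective spaces, in each factor. *)
Definition ratio v x : E := \row_a (bary x (afacet v a) / bary x (vfacet v a)).

Lemma ratioE v x k j : ratio v x 0 (cell k j) =
  bary x (fct k (lift (v k) j)) / bary x (fct k (v k)).
Proof. by rewrite mxE afacetE vfacetE. Qed.

Definition vdom v x := forall i, bary x (fct i (v i)) != 0.

Definition affine v y : X := fun k =>
  \row_j (if unlift (v k) j is Some i then y 0 (cell k i) else 1).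

Lemma affine_vertex v y k : bary (affine v y) (fct k (v k)) = 1.
Proof. by rewrite /bary mxE /= unlift_none. Qed.

Lemma affine_lift v y k j :
  bary (affine v y) (fct k (lift (v k) j)) = y 0 (cell k j).
Proof. by rewrite /bary mxE /= liftK. Qed.

Lemma vertexW v (P : facet -> Prop) : (forall k, P (fct k (v k))) ->
  (forall k j, P (fct k (lift (v k) j))) -> forall f, P f.
Proof.
by move=> P0 P1 [i j]; case: (unliftP (v i) j) => [k ->|->].
Qed.

Definition radius (x : X) (k : 'I_l) : R := Num.sqrt (\sum_j (x k 0 j) ^+ 2).

Definition normalize (x : X) : X := fun k => (radius x k)^-1 *: x k.

Lemma bary_normalize x f :
  bary (normalize x) f = (radius x (tag f))^-1 * bary x f.
Proof. by case: f => k j; rewrite /bary /normalize mxE. Qed.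

Lemma radius_gt0 v x k : vdom v x -> 0 < radius x k.
Proof.
move=> xv; rewrite sqrtr_gt0 (bigD1 (v k))//= ltr_pwDl//.
  by rewrite exprn_even_gt0//=; exact: xv.
by apply: sumr_ge0 => j _; exact: sqr_ge0.
Qed.

Lemma vdom_affine v y : vdom v (affine v y).
Proof. by move=> i; rewrite affine_vertex oner_eq0. Qed.

Lemma spheres_normalize v x : vdom v x -> spheres (normalize x).
Proof.
move=> xv i; have r0 := radius_gt0 i xv.
under eq_bigr do rewrite /normalize mxE exprMn.
rewrite -mulr_sumr -[X in _ * X]sqr_sqrtr; last first.
  by apply: sumr_ge0 => j _; exact: sqr_ge0.
by rewrite -exprMn mulVf ?expr1n// gt_eqF.
Qed.

Lemma ratio_normalize v w x : vdom v x -> ratio w (normalize x) = ratio w x.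
Proof.
move=> xv; apply: row_cellP => k j; rewrite !ratioE !bary_normalize /=.
by rewrite -mulf_div divff ?mul1r// invr_eq0 gt_eqF// (radius_gt0 _ xv).
Qed.

Lemma ratio_affine v y : ratio v (affine v y) = y.
Proof.
apply: row_cellP => k j.
by rewrite ratioE affine_vertex affine_lift divr1.
Qed.

Lemma affine_ratio v x f : vdom v x ->
  bary (affine v (ratio v x)) f = bary x f / bary x (fct (tag f) (v (tag f))).
Proof.
move=> xv; move: f; apply: (@vertexW v) => k /=.
  by rewrite affine_vertex divff// xv.
by move=> j; rewrite affine_lift ratioE.
Qed.

Lemma normalize_affine_ratio v x : spheres x ->
  (forall k, 0 < bary x (fct k (v k))) -> normalize (affine v (ratio v x)) = x.
Proof.
move=> xS xp; have xv : vdom v x by move=> k; rewrite gt_eqF.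
apply: bary_ext => -[k j]; rewrite bary_normalize affine_ratio//=.
have -> : radius (affine v (ratio v x)) k = (bary x (fct k (v k)))^-1.
  rewrite /radius.
  have E j' : affine v (ratio v x) k 0 j' = x k 0 j' / bary x (fct k (v k)).
    exact: (affine_ratio (fct k j') xv).
  under eq_bigr do rewrite E exprMn.
  rewrite -mulr_suml xS mul1r sqrtr_sqr ger0_norm// invr_ge0.
  exact: ltW.
by rewrite invrK mulrC divfK//; exact: xv.
Qed.

Lemma vdom_sflip v t x : vdom v (sflip t x) <-> vdom v x.
Proof.
split=> h i; have := h i; rewrite bary_sflip mulf_eq0 (negbTE (sgn_neq0 _))//.
Qed.

Lemma sbits_sflip v t x : vdom v x ->
  sbits v (sflip t x) = (\row_i t (fct i (v i))) + sbits v x.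
Proof. by move=> xv; apply/rowP => i; rewrite !mxE bary_sflip sbit_sgn. Qed.

Lemma corr_sflip v t u x : vdom v x ->
  (forall i, t (fct i (v i)) = eps A u (fct i (v i))) ->
  corr v (sflip t x) = u + corr v x.
Proof.
move=> xv tu; rewrite /corr sbits_sflip// -theta_shift; congr (theta v (_ + _)).
by apply/rowP => i; rewrite !mxE tu.
Qed.

Lemma positive_gt0 v x : vdom v x ->
  forall k, 0 < bary (positive v x) (fct k (v k)).
Proof.
move=> xv k; rewrite bary_sflip.
have -> : eps A (corr v x) (fct k (v k)) = sbit (bary x (fct k (v k))).
  by have /rowP /(_ k) := thetaK v (sbits v x); rewrite !mxE.
by rewrite sgn_sbit normr_gt0; exact: xv.
Qed.

Lemma positive_id v x : (forall k, 0 < bary x (fct k (v k))) ->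
  positive v x = x.
Proof.
move=> xp; rewrite /positive /corr.
have -> : sbits v x = 0.
  by apply/rowP => i; rewrite !mxE /sbit ltNge (ltW (xp i)).
by apply: sflip0 => f; rewrite theta0 eps0.
Qed.

Lemma positive_eps v u x : vdom v x ->
  positive v (sflip (eps A u) x) = positive v x.
Proof.
move=> xv; rewrite /positive (corr_sflip (u := u))// -sflipD.
apply: sflip_ext => f.
by rewrite epsD addrAC F2_addxx add0r.
Qed.

(** The effect on the chart at [v] of a sign change [del t]. *)
Definition vphi v (t : Z2 N) : Z2 N := \row_a
  let f := afacet v a in
  del t f + eps A (theta v (\row_i del t (fct i (v i)))) f.

Lemma vphiE v t k j : vphi v t 0 (cell k j) =
  del t (fct k (lift (v k) j)) +
  eps A (theta v (\row_i del t (fct i (v i)))) (fct k (lift (v k) j)).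
Proof. by rewrite mxE /= afacetE. Qed.

Lemma theta_eps v s k : eps A (theta v s) (fct k (v k)) = s 0 k.
Proof. by have /rowP /(_ k) := thetaK v s; rewrite mxE. Qed.

Lemma vphi_additive v : zmod_morphism (vphi v).
Proof.
move=> s t; rewrite -[- t]Z2_opp opprK -[- vphi v t]Z2_opp opprK.
apply: row_cellP => k j; rewrite [RHS]mxE !vphiE delD.
have -> : theta v (\row_i del (s + t) (fct i (v i))) =
    theta v (\row_i del s (fct i (v i))) + theta v (\row_i del t (fct i (v i))).
  apply: (@vrow_inj v); rewrite vrowD !thetaK.
  by apply/rowP => i; rewrite !mxE delD.
by rewrite epsD addrACA.
Qed.

(** If [t] has no effect on the chart, then [del t] is a relation; it vanishes on
    the facets of index [0], so it is zero. *)
Lemma vphi_bij v : bijective (vphi v).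
Proof.
apply: injF_bij => s t st.
have st0 : vphi v (s + t) = 0.
  by rewrite -[t in LHS]Z2_opp vphi_additive st subrr.
set u := theta v (\row_i del (s + t) (fct i (v i))).
have e f : del (s + t) f = eps A u f.
  move: f; apply: (@vertexW v) => k; first by rewrite theta_eps mxE.
  move=> j; have /rowP /(_ (cell k j)) := st0; rewrite vphiE mxE => h.
  rewrite -[LHS]addr0 -(F2_addxx (eps A u (fct k (lift (v k) j)))).
  by rewrite addrA h add0r.
have u0 : u = 0 by apply/rowP => i; rewrite -(eps_ord0 A) -e del_ord0 mxE.
have st' : s + t = 0.
  by apply: row_cellP => i j; rewrite -del_lift e u0 eps0 mxE.
by apply/eqP; rewrite -subr_eq0 -[- t]Z2_opp opprK st'.
Qed.

Lemma ratio_del v t x : vdom v x ->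
  ratio v (positive v (sflip (del t) x)) =
  standard_act (vphi v t) (ratio v (positive v x)).
Proof.
move=> xv; apply: row_cellP => k j; rewrite standard_actE !ratioE vphiE.
set u := theta v _.
have tu i : del t (fct i (v i)) = eps A u (fct i (v i)).
  by rewrite theta_eps mxE.
have E f : bary (positive v (sflip (del t) x)) f =
    sgn (del t f + eps A u f) * bary (positive v x) f.
  rewrite /positive (corr_sflip xv tu) !bary_sflip epsD !sgnD.
  by rewrite mulrACA (mulrC (sgn (eps A u f))).
by rewrite !E -tu F2_addxx sgn0 mul1r mulrA.
Qed.

End AffineCharts.

(** * The smooth structure of the quotient *)

Section ModelCover.
Local Open Scope classical_set_scope.
Local Open Scope ring_scope.
Local Open Scope quotient_scope.
Context {R : realType} {l : nat} {n : 'I_l -> nat}.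
Local Notation N := (\sum_(i < l) n i)%N.
Local Notation E := 'rV[R]_N.
Local Notation X := (simplex_prod_space R n).
Local Notation facet := {i : 'I_l & 'I_(n i).+1}.
Local Notation fct i j := (existT (fun k : 'I_l => 'I_(n k).+1) i j).
Local Notation cell i j := (@tagnat.rank l n (existT (fun k : 'I_l => 'I_(n k)) i j)).
Variable A : 'M['F_2]_(l, N).
Hypothesis gA : good A.
Local Notation vert := (forall i : 'I_l, 'I_(n i).+1).
Local Notation S := (set_type (spheres : set X)).
Local Notation val := (@set_val X spheres).
Local Notation M := (quotient_topology {eq_quot @orbit_rel R l n A}).
Local Notation q := (@model_pi R l n A).
Implicit Types (v w : vert) (x : X) (y : E) (s : S) (m : M) (t : Z2 N).

Lemma near_sbit (a : R) : a != 0 -> \forall b \near a, sbit b = sbit a.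
Proof.
rewrite /sbit; case: ltgtP => // a0 _.
  by apply: filterS (lt_nbhsl a0) => b ->.
by apply: filterS (lt_nbhsr a0) => b b0; rewrite ltNge (ltW b0).
Qed.

Lemma near_vdom v x : vdom v x -> \forall x' \near x, vdom v x'.
Proof.
move=> xv.
apply: (@filter_forall _ _ (fun i x' => bary x' (fct i (v i)) != 0)
  (nbhs x) _) => i.
exact: (@cvgr_neq0 R R _ _ _ _ _ (@continuous_bary _ _ _ _ x) (xv i)).
Qed.

Lemma near_positive v x : vdom v x ->
  \forall x' \near x, positive gA v x' = sflip (eps A (corr gA v x)) x'.
Proof.
move=> xv.
have H : \forall x' \near x, forall i : 'I_l,
    sbit (bary x' (fct i (v i))) = sbit (bary x (fct i (v i))).
  apply: (@filter_forall _ _ (fun i x' => sbit (bary x' (fct i (v i))) =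
    sbit (bary x (fct i (v i)))) (nbhs x) _) => i.
  exact: (@continuous_bary _ _ _ _ x _ (near_sbit (xv i))).
apply: filterS H => x' h; rewrite /positive /corr.
suff -> : sbits v x' = sbits v x by [].
by apply/rowP => i; rewrite !mxE h.
Qed.

Lemma ratio_cvg v x : vdom v x -> {for x, continuous (ratio v)}.
Proof.
move=> xv; apply: (cvg_rowP (F := nbhs x)) => a.
under eq_fun do rewrite mxE.
rewrite mxE; apply: cvgM; first exact: continuous_bary.
by apply: cvgV; [exact: xv|exact: continuous_bary].
Qed.

Lemma ratio_positive_cvg v x : vdom v x ->
  {for x, continuous (ratio v \o positive gA v)}.
Proof.
move=> xv.
have e : \forall x' \near x,
    (ratio v \o sflip (eps A (corr gA v x))) x' = (ratio v \o positive gA v) x'.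
  by apply: filterS (near_positive xv) => x' /= ->.
change ((ratio v \o positive gA v) x' @[x' --> x] -->
  (ratio v \o positive gA v) x).
rewrite -(nbhs_singleton e).
apply: cvg_trans (near_eq_cvg e) _.
apply: continuous_comp; first exact: continuous_sflip.
by apply: ratio_cvg; apply/vdom_sflip.
Qed.

Lemma affine_vertex_fun v k :
  (fun y => bary (affine v y) (fct k (v k))) = cst (1 : R).
Proof. by apply/funext => y; rewrite affine_vertex. Qed.

Lemma affine_lift_fun v k j :
  (fun y => bary (affine v y) (fct k (lift (v k) j))) =
  (fun y => y 0 (cell k j)).
Proof. by apply/funext => y; rewrite affine_lift. Qed.

Lemma continuous_affine v : continuous (@affine R l n v).
Proof.
move=> y; apply: (cvg_bary (F := nbhs y)).
apply: (@vertexW _ _ v (fun f => bary (affine v y') f @[y' --> y] -->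
  bary (affine v y) f)) => k.
  by rewrite affine_vertex_fun affine_vertex; exact: (@cst_continuous _ _ (1 : R) y).
by move=> j; rewrite affine_lift_fun affine_lift; exact: coord_continuous.
Qed.

Lemma normalize_cvg v x : vdom v x -> {for x, continuous (@normalize R l n)}.
Proof.
move=> xv; apply: (cvg_bary (F := nbhs x)) => f.
under eq_fun do rewrite bary_normalize.
rewrite bary_normalize; apply: cvgM; last exact: continuous_bary.
apply: cvgV; first by rewrite gt_eqF// (radius_gt0 _ xv).
rewrite /radius; apply: (continuous_cvg _ (@sqrt_continuous R _)).
apply: cvg_sumr => j; under eq_fun do rewrite expr2.
rewrite expr2; apply: cvgM;
  exact: (@continuous_bary _ _ _ (fct (tag f) j) x).
Qed.

Lemma repr_model_pi s : exists u, val (repr (q s)) = sflip (eps A u) (val s).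
Proof.
have /model_pi_eq [u uE] : q s = q (repr (q s)) by rewrite model_pi_repr.
by exists u; rewrite uE.
Qed.

Definition affine_pt v y : S :=
  exist (fun x => x \in spheres) _ (mem_set (spheres_normalize (vdom_affine v y))).

Lemma vdom_affine_pt v y : vdom v (val (affine_pt v y)).
Proof.
move=> k; rewrite bary_normalize affine_vertex mulr1 invr_eq0.
by rewrite gt_eqF// (radius_gt0 _ (vdom_affine v y)).
Qed.

Lemma continuous_affine_pt v : continuous (affine_pt v).
Proof.
move=> y; apply: (@cvg_sphere _ _ _ _ (nbhs y)).
apply: (continuous_cvg _ (normalize_cvg (vdom_affine v y))).
exact: continuous_affine.
Qed.

Definition vchart v : chart R N M :=
  @Chart R N M [set m : M | vdom v (val (repr m))]
    (fun m : M => ratio v (positive gA v (val (repr m))))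
    (fun y => q (affine_pt v y)).

Lemma vchart_dom v s : chart_dom (vchart v) (q s) <-> vdom v (val s).
Proof. by rewrite /=; have [u ->] := repr_model_pi s; exact: vdom_sflip. Qed.

Lemma vchart_fun v s : vdom v (val s) ->
  chart_fun (vchart v) (q s) = ratio v (positive gA v (val s)).
Proof. by move=> sv /=; have [u ->] := repr_model_pi s; rewrite positive_eps. Qed.

Lemma positive_affine_pt v y :
  positive gA v (val (affine_pt v y)) = normalize (affine v y).
Proof.
apply: positive_id => k; rewrite bary_normalize affine_vertex mulr1 invr_gt0.
exact: (radius_gt0 _ (vdom_affine v y)).
Qed.

Lemma vchart_invK v y : chart_fun (vchart v) (chart_inv (vchart v) y) = y.
Proof.
rewrite (vchart_fun (vdom_affine_pt v y)) positive_affine_pt.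
by rewrite (ratio_normalize _ (vdom_affine v y)) ratio_affine.
Qed.

Lemma vchart_inv_dom v y : chart_dom (vchart v) (chart_inv (vchart v) y).
Proof. by apply/vchart_dom; exact: vdom_affine_pt. Qed.

Lemma vchart_cod v : chart_cod (vchart v) = setT.
Proof.
apply/seteqP; split=> // y _; exists (chart_inv (vchart v) y).
  exact: vchart_inv_dom.
exact: vchart_invK.
Qed.

Lemma vchart_funK v m : chart_dom (vchart v) m ->
  chart_inv (vchart v) (chart_fun (vchart v) m) = m.
Proof.
have [s ->] := model_pi_surj m => /vchart_dom sv; rewrite (vchart_fun sv).
apply/esym/model_pi_eq; exists (corr gA v (val s)); apply: sphere_inj.
rewrite val_sact; apply: normalize_affine_ratio; last exact: positive_gt0.
exact: (sphereP (sact (eps A (corr gA v (val s))) s)).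
Qed.

Lemma near_vdom_val v s : vdom v (val s) -> nbhs s [set s' | vdom v (val s')].
Proof. by move=> /near_vdom /(@continuous_sphere_val _ _ _ s). Qed.

Lemma vchart_is_chart v : is_chart (vchart v).
Proof.
split.
- rewrite openE => m; have [s ->] := model_pi_surj m => /vchart_dom sv.
  apply: filterS (model_pi_nbhs A (near_vdom_val sv)) => _ [s' sv' <-].
  exact/vchart_dom.
- by rewrite vchart_cod; exact: openT.
- exact: vchart_funK.
- move=> m; have [s ->] := model_pi_surj m => /vchart_dom sv.
  apply: (@descend_cvg _ _ _ A E (fun s' => ratio v (positive gA v (val s'))) s
    [set s' | vdom v (val s')]).
  + by move=> s' sv'; exact: vchart_fun.
  + exact: near_vdom_val.
  + apply: (@continuous_comp _ _ _ val (ratio v \o positive gA v)).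
      exact: continuous_sphere_val.
    exact: ratio_positive_cvg.
- move=> y _; apply: (@continuous_comp _ _ _ (affine_pt v) q).
    exact: continuous_affine_pt.
  exact: continuous_model_pi.
Qed.

(** On each piece where the signs of the coordinates indexed by [w] are constant,
    the transition is a quotient of affine functions up to sign. *)
Lemma vchart_transition v w :
  smooth_transition (vchart v) (vchart w).
Proof.
apply: smooth_on_local => y0 [m [mv mw] my0].
have {m mv mw my0} y0w : vdom w (affine v y0).
  have e : m = q (affine_pt v y0) by rewrite -(vchart_funK mv) my0.
  move: mw; rewrite e => /vchart_dom h k; have := h k.
  by rewrite bary_normalize mulf_eq0 => /norP[].
have ptw y : vdom w (affine v y) -> vdom w (val (affine_pt v y)).
  move=> h k; rewrite bary_normalize; apply: mulf_neq0; last exact: h.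
  by rewrite invr_eq0 gt_eqF// (radius_gt0 _ (vdom_affine v y)).
pose u := corr gA w (val (affine_pt v y0)).
pose c (f : facet) : R := sgn (eps A u f).
pose G y : E := \row_a
  (c (afacet w a) * bary (affine v y) (afacet w a) *
   (c (vfacet w a) * (bary (affine v y) (vfacet w a))^-1)).
pose B := [set y | vdom w (affine v y) /\
  positive gA w (val (affine_pt v y)) = sflip (eps A u) (val (affine_pt v y))].
have By0 : nbhs y0 B.
  apply: filterI.
    exact: (continuous_affine (near_vdom y0w)).
  have := near_positive (ptw y0 y0w).
  by move=> /(@continuous_sphere_val _ _ _ _) /(@continuous_affine_pt v y0).
have ratB : forall f : facet, rational (B°)%classic (fun y => bary (affine v y) f).
  apply: (@vertexW _ _ v
    (fun f => rational (B°)%classic (fun y => bary (affine v y) f))) => k.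
    by rewrite affine_vertex_fun; exact: rational_cst.
  by move=> j; rewrite affine_lift_fun; exact: rational_coord.
exists (B°)%classic, G; split.
- exact: open_interior.
- exact: By0.
- apply: smooth_on_rational; first exact: open_interior.
  move=> a.
  have -> : (fun y => G y 0 a) =
      (cst (c (afacet w a)) * (fun y => bary (affine v y) (afacet w a)) *
       (cst (c (vfacet w a)) *
        (fun y => (bary (affine v y) (vfacet w a))^-1)) : E -> R).
    by apply/funext => y; rewrite mxE.
  apply: rational_mul; apply: rational_mul; try exact: rational_cst.
    exact: ratB.
  apply: rational_inv; first exact: ratB.
  by move=> y /interior_subset [+ _]; apply.
move=> y /interior_subset [yw yE].
rewrite [LHS](vchart_fun (ptw y yw)) yE.
apply: row_cellP => k j; rewrite ratioE mxE afacetE vfacetE !bary_sflip.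
rewrite !bary_normalize /=.
have r0 : (radius (affine v y) k)^-1 != 0.
  by rewrite invr_eq0 gt_eqF// (radius_gt0 _ (vdom_affine v y)).
have cc (f : facet) : (c f)^-1 = c f.
  by apply: (mulfI (sgn_neq0 (eps A u f))); rewrite divff ?sgn_neq0// sgn_sqr.
rewrite -/(c _) -/(c _) !invfM cc.
rewrite -!mulrA; congr (_ * _); rewrite mulrCA; congr (_ * _).
by rewrite mulrCA; congr (_ * _); rewrite mulrA mulfV ?mul1r.
Qed.

Definition model_atlas : set (chart R N M) := [set c | exists v, c = vchart v].

Lemma vdom_exists x : spheres x -> exists v, vdom v x.
Proof.
move=> xS.
have ex i : exists j : 'I_(n i).+1, bary x (fct i j) != 0.
  apply: contrapT => nex.
  have : \sum_j (x i 0 j) ^+ 2 = 0.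
    rewrite big1// => j _; apply/eqP; rewrite sqrf_eq0.
    by apply: contrapT => /negP h; apply: nex; exists j.
  by rewrite xS => /eqP; rewrite oner_eq0.
exists (fun i => sval (cid (ex i))) => i.
by case: cid.
Qed.

Lemma model_smooth : smooth_atlas model_atlas.
Proof.
split=> [_ [v ->]|m|_ _ [v ->] [w ->]]; first exact: vchart_is_chart.
  have [s ->] := model_pi_surj m; have [v sv] := vdom_exists (sphereP s).
  by exists (vchart v); [exists v|exact/vchart_dom].
exact: vchart_transition.
Qed.

Definition model_act t m : M := q (sact (del t) (repr m)).

Lemma model_actE t s : model_act t (q s) = q (sact (del t) s).
Proof.
have /model_pi_eq [u uE] : q s = q (repr (q s)) by rewrite model_pi_repr.
apply/esym/model_pi_eq; exists u; rewrite uE; exact: sactC.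
Qed.

Lemma vchart_standard v : standard_chart model_atlas model_act (vchart v).
Proof.
split.
- split; first exact: vchart_is_chart.
  by move=> _ [w ->]; split; exact: vchart_transition.
- move=> t m; have [s ->] := model_pi_surj m => /vchart_dom sv.
  by rewrite model_actE; apply/vchart_dom/vdom_sflip.
- pose phi : {additive Z2 N -> Z2 N} :=
    HB.pack (vphi gA v) (GRing.isZmodMorphism.Build _ _ _ (vphi_additive gA v)).
  exists phi; first exact: vphi_bij.
  move=> t m; have [s ->] := model_pi_surj m => /vchart_dom sv.
  rewrite model_actE !vchart_fun//; last exact/vdom_sflip.
  exact: ratio_del.
Qed.

Definition model_proj m : X := square (val (repr m)).

Lemma model_projE s : model_proj (q s) = square (val s).
Proof. by rewrite /model_proj; have [u ->] := repr_model_pi s; rewrite square_sflip. Qed.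

(** The stabilizers of the quotient action: a sign change [del t] fixes the
    class of a point when it agrees with some relation off its zero set. *)
Lemma model_fix t s : model_act t (q s) = q s <->
  exists2 w, forall f, w f = 0 \/ bary (val s) f = 0 & t = comb (lamA A) w.
Proof.
rewrite model_actE; split=> [/esym/model_pi_eq [u uE]|[w ws tE]].
  exists (fun f => del t f + eps A u f).
    apply/sflip_fix; rewrite sflipD.
    have h : sact (del t) (sact (eps A u) s) = s by rewrite -uE sactK.
    exact: (congr1 val h).
  by rewrite combD comb_del comb_eps addr0.
apply/esym/model_pi_eq; exists (\row_i w (fct i ord0)); apply: sphere_inj.
rewrite !val_sact.
have {2}<- : sflip w (val s) = val s by apply/sflip_fix.
rewrite -sflipD; apply: sflip_ext => f.
by rewrite (colouring_split A w f) -tE addrCA F2_addxx addr0.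
Qed.

End ModelCover.

(** * Every normal form is realized *)

Section ModelExists.
Local Open Scope classical_set_scope.
Local Open Scope ring_scope.
Local Open Scope quotient_scope.
Context {R : realType} {l : nat} {n : 'I_l -> nat}.
Local Notation N := (\sum_(i < l) n i)%N.
Local Notation X := (simplex_prod_space R n).
Local Notation facet := {i : 'I_l & 'I_(n i).+1}.
Local Notation fct i j := (existT (fun k : 'I_l => 'I_(n k).+1) i j).
Variable A : 'M['F_2]_(l, N).
Hypothesis gA : good A.
Local Notation S := (set_type (spheres : set X)).
Local Notation val := (@set_val X spheres).
Local Notation M := (quotient_topology {eq_quot @orbit_rel R l n A}).
Local Notation q := (@model_pi R l n A).
Local Notation act := (@model_act R l n A).
Local Notation proj := (@model_proj R l n A).
Local Notation atlas := (@model_atlas R l n A gA).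
Implicit Types (s : S) (m : M) (t : Z2 N).

Lemma model_compact : compact [set: M].
Proof.
have -> : [set: M] = q @` [set: S].
  by apply/seteqP; split=> // m _; have [s ->] := model_pi_surj m; exists s.
apply: continuous_compact; last exact: compact_sphere_type.
by apply: continuous_subspaceT; exact: continuous_model_pi.
Qed.

Lemma model_act0 m : act 0 m = m.
Proof.
have [s ->] := model_pi_surj m; rewrite model_actE; congr (q _).
apply: sphere_inj; rewrite val_sact; apply: sflip0.
by apply: facetW => i *; rewrite ?del_ord0 ?del_lift ?mxE.
Qed.

Lemma model_actD (t t' : Z2 N) m : act (t + t') m = act t (act t' m).
Proof.
have [s ->] := model_pi_surj m; rewrite !model_actE; congr (q _).
by rewrite -sactD; apply: sact_ext => f; rewrite delD.
Qed.

Lemma model_standard m :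
  exists2 c, standard_chart atlas act c & chart_dom c m.
Proof.
have [s ->] := model_pi_surj m; have [v sv] := vdom_exists (sphereP s).
by exists (vchart gA v); [exact: vchart_standard|exact/vchart_dom].
Qed.

Lemma model_proj_continuous : continuous proj.
Proof.
move=> m; have [s ->] := model_pi_surj m.
apply: (@descend_cvg _ _ _ A X (@square R l n \o val) s setT).
- by move=> s' _; exact: model_projE.
- exact: filterT.
- apply: (@continuous_comp _ _ _ val (@square R l n)).
    exact: continuous_sphere_val.
  exact: continuous_square.
Qed.

Lemma model_proj_range : range proj = simplex_prod R n.
Proof.
apply/seteqP; split=> [_ [m _ <-]|p hp].
  have [s ->] := model_pi_surj m; rewrite model_projE.
  exact/spheres_square/sphereP.
pose x : X := fun i => \row_j Num.sqrt (p i 0 j).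
have xp : square x = p.
  apply: bary_ext => -[i j]; rewrite bary_square /bary mxE sqr_sqrtr//=.
  by have [] := hp i.
have xS : spheres x by apply/spheres_square; rewrite xp.
pose s : S := exist (fun x => x \in spheres) x (mem_set xS).
by exists (q s) => //; rewrite model_projE.
Qed.

Lemma model_proj_fib m m' : proj m = proj m' <-> exists t, m' = act t m.
Proof.
have [s ->] := model_pi_surj m; have [s' ->] := model_pi_surj m'; rewrite !model_projE.
split=> [/square_eq [w wE]|[t]].
  exists (comb (lamA A) w); rewrite model_actE; apply/esym/model_pi_eq.
  exists (\row_i w (fct i ord0)); apply: sphere_inj; rewrite wE !val_sact -sflipD.
  by apply: sflip_ext => f; rewrite (colouring_split A w f) addrC.
rewrite model_actE => /model_pi_eq [u]; move=> /(congr1 (fun z => square (val z))).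
by rewrite !val_sact !square_sflip.
Qed.

(** The order of the isotropy group of a point can be read in any standard chart,
    and from the facets through its image. *)
Lemma model_corners c m : standard_chart atlas act c -> chart_dom c m ->
  zeros (chart_fun c m) = num_facets (proj m).
Proof.
move=> [[[_ _ cK _ _] _] cact [phi phib h]] mc.
have [s sE] := model_pi_surj m.
rewrite num_facetsE zerosE.
apply: (@card_coordinates _ _ (lamA A) phi) => // [t|w wz w0].
  have F : (forall j, phi t 0 j = 0 \/ j \in [set j | chart_fun c m 0 j == 0]%SET)
      <-> act t m = m.
    rewrite (standard_chart_fix t cK cact h mc).
    split=> H j; have [e|] := H j; try by left.
      by rewrite inE => /eqP; right.
    by move=> e; right; rewrite inE; apply/eqP.
  rewrite F sE model_projE zset_square model_fix.
  split=> -[w wz ->]; exists w => // f; have [e|] := wz f; try by left.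
    by move=> e; right; rewrite inE; apply/eqP.
  by rewrite inE => /eqP; right.
have [ns _] := good_nonsingular A; apply: ns => // i.
have [v sv] := vdom_exists (sphereP s).
exists (v i); have [//|] := wz (fct i (v i)).
by rewrite sE model_projE zset_square inE (negbTE (sv i)).
Qed.

Definition model : small_cover R n :=
  SmallCover (@model_hausdorff R l n A) model_compact (model_smooth gA)
    model_act0 model_actD model_standard model_proj_continuous
    model_proj_range model_proj_fib model_corners.

Lemma model_has_form : has_form model A.
Proof.
exists idfun; first by exists idfun.
move=> m t /=; have [s ->] := model_pi_surj m.
have H := model_fix A t s.
split=> [/H|] [w wz tE].
  exists w => // f; rewrite model_projE bary_square.
  by have [|->] := wz f; [left|right; rewrite expr0n].
apply/H; exists w => // f; have [|/eqP] := wz f; first by left.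
by rewrite model_projE bary_square sqrf_eq0 => /eqP; right.
Qed.

End ModelExists.

(** * Counting normal forms by acyclic digraphs *)

Section Acyclic.
Context {l : nat}.
Implicit Types (G : digraph l) (U : {set 'I_l}) (i k : 'I_l).

Definition sinkless G U :=
  (U != finset.set0) && [forall k in U, exists i in U, edge G k i].

Lemma sinklessP G U : sinkless G U ->
  (exists k, k \in U) /\ forall k, k \in U -> exists2 i, i \in U & edge G k i.
Proof.
move=> /andP[/finset.set0Pn U0 /forall_inP h]; split=> // k /h /exists_inP [i iU ki].
by exists i.
Qed.

(** The image of a successor map on [U] is again without sinks, so it is [U]. *)
Lemma minset_sinkless_inj G U (f : 'I_l -> 'I_l) : minset (sinkless G) U ->
  (forall k, k \in U -> f k \in U /\ edge G k (f k)) ->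
  f @: U = U /\ {in U &, injective f}.
Proof.
move=> /minsetP [sU minU] fU.
have [[k0 k0U] _] := sinklessP sU.
have e : f @: U = U.
  apply: minU.
    apply/andP; split; first by apply/finset.set0Pn; exists (f k0); exact: imset_f.
    apply/forall_inP => _ /imsetP [k /fU [fkU _] ->]; apply/exists_inP.
    by exists (f (f k)); [exact: imset_f|have [] := fU _ fkU].
  by apply/fintype.subsetP => _ /imsetP [k /fU [fkU _] ->].
by split=> //; apply/imset_injP; rewrite e.
Qed.

(** In a minimal set without sinks every node has a single successor:
    otherwise redirecting one edge would make some successor map not
    injective. *)
Lemma minset_sinkless_uniq G U k i i' : minset (sinkless G) U ->
  k \in U -> i \in U -> i' \in U -> edge G k i -> edge G k i' -> i = i'.
Proof.
move=> mU kU iU i'U ki ki'; have /minsetP [sU _] := mU.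
have [_ succ] := sinklessP sU.
pose s x := odflt x [pick y in U | edge G x y].
have sP x : x \in U -> s x \in U /\ edge G x (s x).
  move=> /succ [y yU xy]; rewrite /s; case: pickP => [z /andP[]//|/(_ y)].
  by rewrite /= yU xy.
pose r j x := if x == k then j else s x.
have rP j : j \in U -> edge G k j ->
    forall x, x \in U -> r j x \in U /\ edge G x (r j x).
  by move=> jU kj x xU; rewrite /r; case: eqP => [->|_] //; exact: sP.
have [rU _] := minset_sinkless_inj mU (rP i iU ki).
have [_ r_inj] := minset_sinkless_inj mU (rP i' i'U ki').
have : i' \in r i @: U by rewrite rU.
move=> /imsetP [x xU]; rewrite {1}/r; case: eqP => [//|/eqP xk i'x].
have : r i' x = r i' k by rewrite /r eqxx (negbTE xk).
by move/(r_inj _ _ xU kU)/eqP; rewrite (negbTE xk).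
Qed.

(** The nodes of a cycle form a set without sinks. Conversely, a successor map on
    a minimal set without sinks is a permutation, and its orbits are cycles. *)
Lemma acyclic_sink G : acyclic G <-> forall U, ~~ sinkless G U.
Proof.
split=> [acG U|sink [c c0 /andP[cyc _]]].
  apply/negP => /minset_exists [V mV _]; apply: acG.
  have /minsetP [sV _] := mV; have [[x0 x0V] succ] := sinklessP sV.
  pose s x := odflt x [pick y in V | edge G x y].
  have sP x : x \in V -> s x \in V /\ edge G x (s x).
    move=> /succ [y yV xy]; rewrite /s; case: pickP => [z /andP[]//|/(_ y)].
    by rewrite /= yV xy.
  have [_ s_inj] := minset_sinkless_inj mV sP.
  pose g x := if x \in V then s x else x.
  have g_inj : injective g.
    move=> x y; rewrite /g; case: ifPn => xV; case: ifPn => yV // e.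
    - exact: s_inj.
    - by have [+ _] := sP x xV; rewrite e (negbTE yV).
    - by have [+ _] := sP y yV; rewrite -e (negbTE xV).
  have gV x : x \in fingraph.orbit g x0 -> x \in V.
    move=> /trajectP [m _ ->]; elim: m => //= m IH.
    by rewrite {1}/g IH; have [] := sP _ IH.
  exists (fingraph.orbit g x0).
    by move=> e; have := fingraph.in_orbit g x0; rewrite e.
  rewrite /ucycle fingraph.orbit_uniq andbT.
  apply: (@sub_in_cycle _ (mem V) (frel g) (edge G)).
  - by move=> x y xV _ /eqP <-; rewrite /g xV; have [] := sP x xV.
  - by apply/allP => x /gV.
  - exact: fingraph.cycle_orbit.
have /negP := sink [set x in c]%SET; apply; apply/andP; split.
  by case: c c0 {cyc} => // x c _; apply/finset.set0Pn; exists x; rewrite inE mem_head.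
apply/forall_inP => x; rewrite inE => xc; apply/exists_inP.
by exists (next c x); [rewrite inE mem_next|exact: next_cycle].
Qed.

End Acyclic.

Section Counting.
Local Open Scope ring_scope.
Context {l : nat} {n : 'I_l -> nat}.
Local Notation N := (\sum_(i < l) n i)%N.
Local Notation fct i j := (existT (fun k : 'I_l => 'I_(n k).+1) i j).
Local Notation cell i j := (@tagnat.rank l n (existT (fun k : 'I_l => 'I_(n k)) i j)).
Implicit Types (A : 'M['F_2]_(l, N)) (i k : 'I_l).

Definition blk A i k : 'rV['F_2]_(n k) := \row_j A i (cell k j).

Definition blk_digraph A : digraph l :=
  [set p | (p.1 != p.2) && (blk A p.2 p.1 != 0)]%SET.

Lemma edge_blk A k i :
  edge (blk_digraph A) k i = (k != i) && (blk A i k != 0).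
Proof. by rewrite /edge inE. Qed.

(** For a minimal set of nodes without sinks, the sum of the corresponding rows
    has, in the block of each of these nodes, an entry [1 + 1] coming from the
    diagonal block and from the only successor. On the other hand, at a sink of
    the support of a relation only the diagonal block contributes. *)
Lemma good_blocks A : good A <->
  (forall i, blk A i i = const_mx 1) /\ acyclic (blk_digraph A).
Proof.
rewrite acyclic_sink; split=> [gA|[ones sink] u u0].
  have ones i : blk A i i = const_mx 1.
    have [|i' hi'] := gA (delta_mx 0 i).
      by apply/eqP => /rowP /(_ i) /eqP; rewrite !mxE !eqxx oner_eq0.
    have i'i : i' = i.
      have /eqP := hi' ord0; rewrite eps_ord0 mxE eqxx -F2_neq0 /=.
      by case: (i' =P i) => //= _; rewrite ?mulr0n eqxx.
    rewrite {}i'i in hi'; apply/rowP => j; rewrite !mxE.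
    by have := hi' (lift ord0 j); rewrite eps_lift -rowE mxE.
  split=> // U; apply/negP => /minset_exists [V mV _].
  have /minsetP [sV _] := mV; have [[k0 k0V] succ] := sinklessP sV.
  pose u : 'rV['F_2]_l := \row_i (i \in V)%:R.
  have [|k hk] := gA u.
    by apply/eqP => /rowP /(_ k0) /eqP; rewrite !mxE k0V oner_eq0.
  have kV : k \in V.
    have /eqP := hk ord0; rewrite eps_ord0 mxE -F2_neq0.
    by case: (k \in V) => //=; rewrite ?mulr0n eqxx.
  have [i iV ki] := succ k kV.
  have := ki; rewrite edge_blk => /andP[kni] /eqP b0.
  have [j Aij] : exists j, A i (cell k j) != 0.
    apply: contrapT => nex; apply: b0; apply/rowP => j; rewrite !mxE.
    by apply/eqP; apply: contrapT => /negP h; apply: nex; exists j.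
  have := hk (lift ord0 j); rewrite eps_lift mxE (bigD1 k)//= [X in _ + X](bigD1 i)/=; last first.
    by rewrite eq_sym.
  have := ones k => /rowP /(_ j); rewrite !mxE => ->.
  move: Aij; rewrite F2_neq0 => /eqP ->; rewrite kV iV [X in _ + (_ + X)]big1 ?addr0; last first.
    move=> i' /andP[i'k i'i]; rewrite mxE.
    case: (boolP (i' \in V)) => [i'V|_]; last by rewrite mul0r.
    have : ~~ edge (blk_digraph A) k i'.
      apply/negP => ki'; move/eqP: i'i; apply.
      exact: (minset_sinkless_uniq mV kV i'V iV).
    rewrite edge_blk eq_sym i'k negbK => /eqP /rowP /(_ j).
    by rewrite !mxE => ->; rewrite mulr0.
  by rewrite !mulr1 F2_addxx => /esym/eqP; rewrite oner_eq0.
pose U := [set i | u 0 i != 0]%SET.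
have U0 : U != finset.set0.
  apply: contraNneq u0 => /setP U0; apply/eqP/rowP => i; rewrite mxE.
  by have := U0 i; rewrite !inE => /negbFE/eqP.
have := sink U; rewrite /sinkless U0 /= => /forall_inPn [k kU] /exists_inPn nk.
have uk : u 0 k = 1 by move: kU; rewrite inE F2_neq0 => /eqP.
exists k => j; case: (unliftP ord0 j) => [j' ->|->]; last by rewrite eps_ord0.
rewrite eps_lift mxE (bigD1 k)//= uk mul1r [X in _ + X]big1 ?addr0.
  by have /rowP /(_ j') := ones k; rewrite !mxE.
move=> i ik; have [->|ui] := eqVneq (u 0 i) 0; first by rewrite mul0r.
have := nk i; rewrite inE ui => /(_ isT).
rewrite edge_blk eq_sym ik negbK => /eqP /rowP /(_ j').
by rewrite !mxE => ->; rewrite mulr0.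
Qed.

Definition blocks A : {dffun forall p : 'I_l * 'I_l, 'rV['F_2]_(n p.2)} :=
  [ffun p => blk A p.1 p.2].

Lemma blocks_bij : bijective blocks.
Proof.
exists (fun f : {dffun forall p : 'I_l * 'I_l, 'rV['F_2]_(n p.2)} =>
  \matrix_(i, a) f (i, tag (tagnat.sig a)) 0 (tagged (tagnat.sig a))).
  move=> A; apply/matrixP => i a; rewrite mxE ffunE mxE /=.
  congr (A i _); rewrite -[RHS]tagnat.sigK; congr tagnat.rank.
  by case: (tagnat.sig a).
move=> f; apply/ffunP => -[i k]; rewrite ffunE; apply/rowP => j.
by rewrite !mxE tagnat.rankK.
Qed.

Lemma card_blk_digraph (G : digraph l) : acyclic G ->
  #|[set A | [forall i, blk A i i == const_mx 1] && (blk_digraph A == G)]%SET| =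
  (\prod_(k < l) (2 ^ n k - 1) ^ outdeg G k)%N.
Proof.
move=> acG.
have noloop k : (k, k) \notin G.
  apply/negP => kk; apply: acG; exists [:: k] => //.
  by rewrite /ucycle /= /edge kk.
pose F (p : 'I_l * 'I_l) : pred 'rV['F_2]_(n p.2) :=
  if p.1 == p.2 then pred1 (const_mx 1)
  else if (p.2, p.1) \in G then predC1 0 else pred1 0.
have -> : [set A | [forall i, blk A i i == const_mx 1] && (blk_digraph A == G)]%SET
    = (blocks @^-1: (family F))%SET.
  apply/setP => A; rewrite !inE; apply/andP/familyP => [[/forallP ones /eqP GE] [i k]|h].
    rewrite ffunE /F /= -GE; have [->|ik] := eqVneq i k; first by rewrite inE ones.
    by rewrite inE /= eq_sym ik /=; case: (eqVneq (blk A i k) 0) => b;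
      rewrite ?inE /= ?b ?eqxx.
  split.
    by apply/forallP => i; have := h (i, i); rewrite ffunE /F /= eqxx.
  apply/eqP/setP => -[k i]; rewrite inE /=; have := h (i, k); rewrite ffunE /F /=.
  have [->|ik] := eqVneq i k; first by rewrite /= (negbTE (noloop k)).
  case: ((k, i) \in G); rewrite inE /=; first by move=> ->.
  by move=> ->.
rewrite on_card_preimset; last exact/onW_bij/blocks_bij.
rewrite card_family foldrE big_map big_enum /=.
rewrite (eq_bigr (fun p => if (p.2, p.1) \in G then 2 ^ n p.2 - 1 else 1)%N).
  rewrite -(pair_bigA _ (fun i k => if (k, i) \in G then 2 ^ n k - 1 else 1)%N) /=.
  rewrite exchange_big /=; apply: eq_bigr => k _.
  by rewrite -big_mkcond /= prod_nat_const; congr (_ ^ _)%N; apply: eq_card.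
move=> [i k] _ /=; rewrite /F /=; have [->|ik] := eqVneq i k.
  by rewrite (negbTE (noloop k)) card1.
case: ((k, i) \in G); last by rewrite card1.
by rewrite cardC1 card_mx card_Fp// mul1n subn1.
Qed.

Lemma card_good :
  #|[set A : 'M['F_2]_(l, N) | `[< good A >]]%SET| =
  (\sum_(G : digraph l | `[< acyclic G >])
     \prod_(i < l) (2 ^ n i - 1) ^ outdeg G i)%N.
Proof.
rewrite -sum1_card (partition_big blk_digraph (fun G => `[< acyclic G >])) /=.
  apply: eq_bigr => G /asboolP acG; rewrite -card_blk_digraph// -sum1_card.
  apply: eq_bigl => A; rewrite !inE.
  have [e|] := eqVneq (blk_digraph A) G; last by rewrite !andbF.
  rewrite !andbT; apply/asboolP/forallP => [/good_blocks [ones _] i|ones].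
    by rewrite ones.
  by apply/good_blocks; rewrite e; split => // i; exact/eqP.
by move=> A; rewrite inE => /asboolP /good_blocks [_ ac]; exact/asboolP.
Qed.

End Counting.

(** * The number of classes *)

(** The class of a matrix consists of the small covers that have it as normal
    form. *)
Lemma classes_by_normal_form (R : realType) (l : nat) (n : 'I_l -> nat) :
  (forall i, (0 < n i)%N) ->
  num_classes (@DJ_equiv R l n)
    #|[set A : 'M['F_2]_(l, \sum_(i < l) n i) | `[< good A >]]%SET|.
Proof.
move=> n0; set D := [set A | _]%SET.
have goodD (i : 'I_#|D|) : good (enum_val i).
  by have := enum_valP i; rewrite inE => /asboolP.
have classE A (M0 : small_cover R n) : has_form M0 A ->
    (fun M => has_form M A) = DJ_equiv M0.
  move=> h0; apply: functional_extensionality_dep => M; apply: propext; split.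
    exact: DJ_equiv_of_form.
  by move=> /has_form_DJ; apply.
exists (fun i (M : small_cover R n) => has_form M (enum_val i)).
  move=> i j ij; apply: enum_val_inj.
  have hi := model_has_form (R := R) (goodD i).
  apply: (has_form_inj n0 (goodD i) (goodD j) hi).
  by rewrite -(congr1 (fun P => P (model (goodD i))) ij).
move=> P; split=> [[i <-]|[M ->]].
  by exists (model (goodD i)); apply: classE; exact: model_has_form.
have [A gA hA] := has_form_exists M n0.
have AD : A \in D by rewrite inE; exact/asboolP.
exists (enum_rank_in AD A); rewrite enum_rankK_in//.
exact: classE.
Qed.

Theorem theorem2p8 (R : realType) (l : nat) (n : 'I_l -> nat)
    (l_gt0 : (0 < l)%N) (n_gt0 : forall i : 'I_l, (0 < n i)%N) :
  num_classes (@DJ_equiv R l n)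
    (\sum_(G : digraph l | `[< acyclic G >])
       \prod_(i < l) (2 ^ n i - 1) ^ outdeg G i)%N.
Proof. by rewrite -card_good; exact: classes_by_normal_form. Qed.
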